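(* Let $R>0$, let $\theta\in(0,\pi/2)$ be fixed, and let $m\ge 1$ be an integer. Let $\mathbf{f}$ be a symmetric $m$-tensor field on $\mathbb{R}^2$ each of whose components is smooth and compactly supported in the disk $\mathbb{D}_{R\sin\theta}$. Then $\mathbf{f}$ can be recovered explicitly, with an inversion formula, from the knowledge of the V-line transforms $\mathcal{L}\mathbf{f}(\phi,d)$, $\mathcal{T}\mathbf{f}(\phi,d)$ and $\mathcal{M}^{(k)}\mathbf{f}(\phi,d)$, $1\le k\le m-1$, for all $d\in[0,2R]$ and $\phi\in[0,2\pi)$. That is, there is an explicit inversion formula which, for every such $\mathbf{f}$, expresses $\mathbf{f}$ in terms of the functions $\mathcal{L}\mathbf{f},\ \mathcal{T}\mathbf{f},\ \mathcal{M}^{(1)}\mathbf{f},\dots,\mathcal{M}^{(m-1)}\mathbf{f}$ on $[0,2\pi)\times[0,2R]$.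
   Context: For $\rho>0$, $\mathbb{D}_\rho$ denotes the disk in $\mathbb{R}^2$ of radius $\rho$ centered at the origin. A symmetric $m$-tensor field $\mathbf{f}$ on $\mathbb{R}^2$ has components $f_{i_1i_2\cdots i_m}$, $i_1,\dots,i_m\in\{1,2\}$, symmetric in their indices; fields supported in a disk are extended by zero to all of $\mathbb{R}^2$. The pairing of symmetric $m$-tensors is $\langle \mathbf{f},\mathbf{g}\rangle=\sum_{i_1,\dots,i_m=1}^{2} f_{i_1\cdots i_m}g^{i_1\cdots i_m}$. For $\mathbf{u}\in\mathbb{R}^2$, $\mathbf{u}^m$ is the tensor with components $u^{i_1}\cdots u^{i_m}$. For $\mathbf{u},\mathbf{w}\in\mathbb{R}^2$, $\mathbf{w}^k\mathbf{u}^{m-k}$ is the tensor with components $w^{i_1}\cdots w^{i_k}u^{i_{k+1}}\cdots u^{i_m}$. For $\phi\in\mathbb{R}$ set $\mathbf{x}_\phi=(R\cos\phi,R\sin\phi)$, $\mathbf{u}_\phi=-(\cos\phi,\sin\phi)$, $\mathbf{v}_\phi=-(\cos(\theta+\phi),\sin(\theta+\phi))$, $\mathbf{u}_\phi^\perp=(\sin\phi,-\cos\phi)$, $\mathbf{v}_\phi^\perp=(\sin(\theta+\phi),-\cos(\theta+\phi))$. The broken ray with parameters $(\phi,d)$ starts at $\mathbf{x}_\phi$, travels distance $d$ in direction $\mathbf{u}_\phi$, and then travels along the half-line in direction $\mathbf{v}_\phi$. For $\phi\in[0,2\pi)$ and $d\in[0,2R]$ define: the longitudinal V-line transform $$\mathcal{L}\mathbf{f}(\phi,d)=\int_0^d\langle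 \mathbf{f}(\mathbf{x}_\phi+s\mathbf{u}_\phi),\mathbf{u}_\phi^m\rangle\,ds+\int_0^\infty\langle \mathbf{f}(\mathbf{x}_\phi+d\mathbf{u}_\phi+s\mathbf{v}_\phi),\mathbf{v}_\phi^m\rangle\,ds;$$ the transverse V-line transform $$\mathcal{T}\mathbf{f}(\phi,d)=\int_0^d\langle \mathbf{f}(\mathbf{x}_\phi+s\mathbf{u}_\phi),(\mathbf{u}_\phi^\perp)^m\rangle\,ds+\int_0^\infty\langle \mathbf{f}(\mathbf{x}_\phi+d\mathbf{u}_\phi+s\mathbf{v}_\phi),(\mathbf{v}_\phi^\perp)^m\rangle\,ds;$$ and, for $1\le k\le m-1$, the mixed V-line transform $$\mathcal{M}^{(k)}\mathbf{f}(\phi,d)=\int_0^d\langle \mathbf{f}(\mathbf{x}_\phi+s\mathbf{u}_\phi),(\mathbf{u}_\phi^\perp)^k\mathbf{u}_\phi^{m-k}\rangle\,ds+\int_0^\infty\langle \mathbf{f}(\mathbf{x}_\phi+d\mathbf{u}_\phi+s\mathbf{v}_\phi),(\mathbf{v}_\phi^\perp)^k\mathbf{v}_\phi^{m-k}\rangle\,ds.$$ For $m=1$ there are no mixed transforms. *)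

(* Defs.v *)
From Stdlib Require Import Reals ZArith List Permutation.
From Coquelicot Require Import Coquelicot.

Open Scope R_scope.

(** * Symmetric tensor fields on the plane *)

Inductive axis : Set := ax1 | ax2.

Definition coord (u : R * R) (i : axis) : R :=
  match i with ax1 => fst u | ax2 => snd u end.

Definition count_ax2 (I : list axis) : nat :=
  length (filter (fun i => match i with ax1 => false | ax2 => true end) I).

(** A tensor of order [m] is given by its components on multi-indices, i.e.
    words in [axis]; only the words of length [m] are ever used. *)
Definition tensor := list axis -> R.
Definition tensor_field := list axis -> R -> R -> R.

(** Sum over all multi-indices of length [m]. *)
Fixpoint sum_words {G : AbelianMonoid} (m : nat) (g : list axis -> G) : G :=
  match m with
  | O => g nil
  | S m' => plus (sum_words m' (fun I => g (ax1 :: I)))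
                 (sum_words m' (fun I => g (ax2 :: I)))
  end.

Definition pairing (m : nat) (f g : tensor) : R :=
  sum_words m (fun I => f I * g I).

(** [tpow u] is the tensor u^m, and [mixed_tpow k w u] is w^k u^(m-k), where
    [m] is the length of the multi-index at which they are evaluated. *)
Fixpoint tpow (u : R * R) (I : list axis) : R :=
  match I with
  | nil => 1
  | i :: I' => coord u i * tpow u I'
  end.

Fixpoint mixed_tpow (k : nat) (w u : R * R) (I : list axis) : R :=
  match k, I with
  | S k', i :: I' => coord w i * mixed_tpow k' w u I'
  | _, _ => tpow u I
  end.

Definition symmetric_field (m : nat) (f : tensor_field) : Prop :=
  forall I J, length I = m -> Permutation I J ->
  forall x y, f I x y = f J x y.

Definition smooth (g : R -> R -> R) : Prop :=
  forall n x y, ex_diff_n g n x y.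

(** The support is contained in the closed disk of radius [rho] centered at the
    origin (hence is compact). *)
Definition supported_in_disk (rho : R) (g : R -> R -> R) : Prop :=
  forall x y, rho ^ 2 < x ^ 2 + y ^ 2 -> g x y = 0.

(** * V-line transforms; [Rad] is the radius R *)

Definition xpt (Rad phi : R) : R * R := (Rad * cos phi, Rad * sin phi).
Definition udir (phi : R) : R * R := (- cos phi, - sin phi).
Definition vdir (theta phi : R) : R * R :=
  (- cos (theta + phi), - sin (theta + phi)).
Definition uperp (phi : R) : R * R := (sin phi, - cos phi).
Definition vperp (theta phi : R) : R * R :=
  (sin (theta + phi), - cos (theta + phi)).

Definition move (x : R * R) (s : R) (u : R * R) : R * R :=
  (fst x + s * fst u, snd x + s * snd u).

Definition field_at (f : tensor_field) (x : R * R) : tensor :=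
  fun I => f I (fst x) (snd x).

(** Integral along the broken ray with parameters [(phi, d)] of the field
    paired with [A] on the first branch and with [B] on the second one. *)
Definition vline (Rad theta : R) (m : nat) (f : tensor_field)
    (A B : tensor) (phi d : R) : R :=
  RInt (fun s => pairing m (field_at f (move (xpt Rad phi) s (udir phi))) A) 0 d
  + RInt_gen (fun s => pairing m
      (field_at f (move (move (xpt Rad phi) d (udir phi)) s (vdir theta phi))) B)
      (at_point 0) (Rbar_locally p_infty).

Definition longitudinal (Rad theta : R) (m : nat) (f : tensor_field)
    (phi d : R) : R :=
  vline Rad theta m f (tpow (udir phi)) (tpow (vdir theta phi)) phi d.

Definition transverse (Rad theta : R) (m : nat) (f : tensor_field)
    (phi d : R) : R :=
  vline Rad theta m f (tpow (uperp phi)) (tpow (vperp theta phi)) phi d.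

Definition mixed (Rad theta : R) (m k : nat) (f : tensor_field)
    (phi d : R) : R :=
  vline Rad theta m f (mixed_tpow k (uperp phi) (udir phi))
    (mixed_tpow k (vperp theta phi) (vdir theta phi)) phi d.

(** * The inversion formula

    Put e(a) = (cos a, sin a), a = phi + PI, q = (number of [ax1] in P) -
    (number of [ax2] in P), and let f_P be the component of f along the tensor
    product of the null vectors (1, i) (for [ax1]) and (1, -i) (for [ax2])
    prescribed by the word P.  As u_phi +- i u_phi^perp = exp(-+ i a) (1, +-i),
    and likewise for v_phi with a + theta, the combination G_P of the data
    ([null_data]) equals exp(-i q a) times
      int_0^d f_P ds + exp(-i q theta) int_0^oo f_P ds
    along the two branches of the broken ray.  For d = Rad + r, 0 < r < Rad, the
    vertex is r e(a) and the second branch points away from the origin; it meets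
    the circle of radius rho >= r at the polar angle
    a + theta - asin (r sin theta / rho).  Hence, if c_n is the n-th Fourier
    coefficient of f_P on the circles centered at the origin and S_n (r) that of
    exp(i q a) G_P (phi, Rad + r) in the variable a,
      S_n (Rad) - S_n (r) = int_r^Rad c_n (rho) k_n (r / rho) drho
    with k_n = [kernel].  Differentiating in r gives the Volterra equation
      c_n (r) = (S_n' (r) + int_r^Rad c_n (rho) k_n' (r / rho) / rho drho)
                / k_n (1),
    where k_n (1) <> 0, which is solved by its Neumann series. *)

Definition cis (t : R) : C := (cos t, sin t).

Definition C_integral (g : R -> C) (a b : R) : C :=
  (RInt (fun t => Re (g t)) a b, RInt (fun t => Im (g t)) a b).

Definition C_derivative (g : R -> C) (t : R) : C :=
  (Derive (fun s => Re (g s)) t, Derive (fun s => Im (g s)) t).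

Definition C_series (a : nat -> C) : C :=
  (Series (fun n => Re (a n)), Series (fun n => Im (a n))).

(** [null_frame p i] is the [i]-th coordinate of the null vector [p]; the
    [i]-th basis vector is the sum over [p] of [null_coframe p i] times the
    null vector [p]. *)
Definition null_frame (p i : axis) : C :=
  match p, i with
  | _, ax1 => RtoC 1
  | ax1, ax2 => Ci
  | ax2, ax2 => (- Ci)%C
  end.

Definition null_coframe (p i : axis) : C :=
  match p, i with
  | _, ax1 => (1 / 2)%C
  | ax1, ax2 => (- Ci / 2)%C
  | ax2, ax2 => (Ci / 2)%C
  end.

Fixpoint coef_product (A : axis -> axis -> C) (P I : list axis) : C :=
  match P, I with
  | p :: P', i :: I' => (A p i * coef_product A P' I')%C
  | _, _ => RtoC 1
  end.

Definition spin (P : list axis) : Z :=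
  (Z.of_nat (length P) - 2 * Z.of_nat (count_ax2 P))%Z.

(** [gL], [gT] and [gM k] are the measured values of the longitudinal,
    transverse and mixed transforms. *)
Definition data_component (m : nat) (gL gT : R -> R -> R)
    (gM : nat -> R -> R -> R) (I : list axis) (phi d : R) : R :=
  let k := count_ax2 I in
  if Nat.eqb k 0 then gL phi d
  else if Nat.eqb k m then gT phi d
  else gM k phi d.

Definition null_data (m : nat) (gL gT : R -> R -> R)
    (gM : nat -> R -> R -> R) (P : list axis) (phi d : R) : C :=
  sum_words m (fun I =>
    (coef_product null_frame P I
     * RtoC (data_component m gL gT gM I phi d))%C).

Definition data_fourier (Rad : R) (G : R -> R -> C) (q n : Z) (r : R) : C :=
  (RtoC (/ (2 * PI))
   * C_integral
       (fun phi => G phi (Rad + r)%R * cis (IZR (q - n) * (phi + PI))%R)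
       0 (2 * PI))%C.

Definition kernel (theta : R) (q n : Z) (tau : R) : C :=
  (1 - RtoC (/ sqrt (1 - (tau * sin theta) ^ 2))
       * cis (IZR n * (theta - asin (tau * sin theta)) - IZR q * theta))%C.

Definition volterra (Rad theta : R) (q n : Z) (h : R -> C) (r : R) : C :=
  (C_integral
     (fun rho => h rho * C_derivative (kernel theta q n) (r / rho)%R
                 * RtoC (/ rho)) r Rad
   / kernel theta q n 1)%C.

Fixpoint neumann_term (Rad theta : R) (G : R -> R -> C) (q n : Z) (j : nat)
    : R -> C :=
  match j with
  | O => fun r =>
      (C_derivative (data_fourier Rad G q n) r / kernel theta q n 1)%C
  | S j' => volterra Rad theta q n (neumann_term Rad theta G q n j')
  end.

Definition radial_coefficient (Rad theta : R) (G : R -> R -> C) (q n : Z)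
    (r : R) : C :=
  C_series (fun j => neumann_term Rad theta G q n j r).

(** Sum of the Fourier series with coefficients [c] at the point [z] of the
    unit circle, the terms of index n and -n being grouped. *)
Definition fourier_sum (c : Z -> C) (z : C) : C :=
  (c 0%Z + C_series (fun j =>
     c (Z.of_nat (S j)) * z ^ (S j)
     + c (- Z.of_nat (S j))%Z * (Cconj z) ^ (S j)))%C.

Definition null_component (Rad theta : R) (m : nat) (gL gT : R -> R -> R)
    (gM : nat -> R -> R -> R) (P : list axis) (x y : R) : C :=
  let r := sqrt (x ^ 2 + y ^ 2) in
  fourier_sum
    (fun n => radial_coefficient Rad theta (null_data m gL gT gM P) (spin P) n r)
    (x / r, y / r).

Definition punctured_inversion (Rad theta : R) (m : nat) (gL gT : R -> R -> R)
    (gM : nat -> R -> R -> R) (I : list axis) (x y : R) : R :=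
  Re (sum_words m (fun P =>
        (coef_product null_coframe P I
         * null_component Rad theta m gL gT gM P x y)%C)).

(** At the origin, where polar coordinates are singular, the value is the limit
    along the first axis. *)
Definition inversion_formula (Rad theta : R) (m : nat) (gL gT : R -> R -> R)
    (gM : nat -> R -> R -> R) (I : list axis) (x y : R) : R :=
  if Rle_dec (Rad ^ 2) (x ^ 2 + y ^ 2) then 0
  else if Req_EM_T (x ^ 2 + y ^ 2) 0 then
    real (Lim (fun t => punctured_inversion Rad theta m gL gT gM I t 0) 0)
  else punctured_inversion Rad theta m gL gT gM I x y.

(* Main.v *)
(** Exchanging the integrals over the circle and over the broken ray turns the
    [n]-th Fourier mode of the null data into an Abel-type integral of the single
    mode [circle_coef F n]; differentiating at the vertex radius gives a Volterra
    equation of the second kind.  Substituting this equation into the Neumann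
    series makes it telescope, with a remainder bounded by [M (K (Rad - r))^j / j!].
    The modes are summed by Chernoff's argument: from
    [g t - g 0 = (exp (i t) - 1) h t] with [h] continuous, the symmetric partial
    sums of the Fourier series of [g] at [0] are [g 0] up to two Fourier
    coefficients of [h], which vanish in the limit by the Riemann-Lebesgue lemma.
    On the tensor side, symmetry of [f] makes the pairing with a product of [u]'s
    and [u_perp]'s independent of their order, so the measured transforms determine
    all components in the null frame. *)

Require Import Defs.
From Stdlib Require Import Reals ZArith List.
From Coquelicot Require Import Coquelicot.
From Stdlib Require Import Permutation Lra Lia FunctionalExtensionality.

Open Scope R_scope.

(** * Parametric integrals *)

(** Three obstacles shape the analysis. The Volterra equation is singular at the centre: its factor
    1 / rho makes the bounds on the iterates depend on a positive lower radius [r0], so the modes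
    are recovered in (0, Rad) and the origin by continuity. At the other end the integrals stop at
    [Rad] while continuity is two-sided; the functions are therefore followed on (0, Rad / sin
    theta), where the kernel stays regular and which contains [Rad] because sin theta < 1. Finally,
    no decay of the Fourier coefficients is established: each series is summed at a single point,
    from differentiability in the angle.

    The condition theta < PI / 2 acts twice. The second branch moves outward, so the radius
    parametrises it; and the kernel at ratio 1 is 1 minus a number of modulus 1 / cos theta > 1, so
    it cannot vanish and the equation can be solved for its leading term. The scalar and the tensor
    side meet in the predicate [spin_data]. *)

Lemma continuous_pt (f : R -> R) x : continuous f x <-> continuity_pt f x.
Proof. split; apply continuity_pt_filterlim. Qed.

Lemma continuity_2d_comp (f g h : R -> R -> R) x y :
  continuity_2d_pt f (g x y) (h x y) ->
  continuity_2d_pt g x y -> continuity_2d_pt h x y ->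
  continuity_2d_pt (fun u v => f (g u v) (h u v)) x y.
Proof.
  intros Hf Hg Hh eps.
  destruct (Hf eps) as [d Hd].
  generalize (locally_2d_and _ _ _ _ (Hg d) (Hh d)).
  apply locally_2d_impl, locally_2d_forall.
  intros u v [H1 H2]. now apply Hd.
Qed.

Lemma continuity_2d_slice_l (f : R -> R -> R) x y :
  continuity_2d_pt f x y -> continuous (fun u => f u y) x.
Proof.
  intros H. apply continuous_pt. intros eps He.
  destruct (H (mkposreal eps He)) as [d Hd].
  exists d; split; [apply cond_pos|].
  intros u [_ Hu]. apply Hd; [exact Hu|].
  rewrite Rminus_diag, Rabs_R0. apply cond_pos.
Qed.

Lemma continuity_2d_slice_r (f : R -> R -> R) x y :
  continuity_2d_pt f x y -> continuous (fun v => f x v) y.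
Proof.
  intros H. apply continuous_pt. intros eps He.
  destruct (H (mkposreal eps He)) as [d Hd].
  exists d; split; [apply cond_pos|].
  intros u [_ Hu]. apply Hd; [|exact Hu].
  rewrite Rminus_diag, Rabs_R0. apply cond_pos.
Qed.

Lemma continuous_2d_l (g : R -> R) x y :
  continuous g x -> continuity_2d_pt (fun u _ => g u) x y.
Proof.
  intros H. apply continuity_1d_2d_pt_comp with (g := fun u _ => u).
  - now apply continuous_pt.
  - apply continuity_2d_pt_id1.
Qed.

Ltac cont2d := repeat first
  [ apply continuity_2d_pt_const | apply continuity_2d_pt_id1
  | apply continuity_2d_pt_id2 | apply continuity_2d_pt_minus
  | apply continuity_2d_pt_plus | apply continuity_2d_pt_opp
  | apply continuity_2d_pt_mult ].

(** By compactness, continuity along the segment {x} x [a, b] is uniform, so a small move of the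
    parameter changes the integrand little for all [t] at once. *)
Lemma continuous_RInt_param (f : R -> R -> R) a b x :
  a <= b ->
  (forall t, a <= t <= b -> continuity_2d_pt f x t) ->
  locally x (fun y => ex_RInt (f y) a b) ->
  continuous (fun y => RInt (f y) a b) x.
Proof.
  intros Hab Hc Hi.
  apply filterlim_locally; intros eps.
  (* The added 1 keeps the denominator positive when [a = b]. *)
  assert (Hpos : 0 < eps / (2 * (b - a + 1))).
  { apply Rdiv_lt_0_compat; [apply cond_pos | lra]. }
  destruct (uniform_continuity_2d_1d' f a b x Hc (mkposreal _ Hpos)) as [d Hd].
  assert (Hloc : locally x (fun y => Rabs (y - x) < d)).
  { exists d; intros y Hy; exact Hy. }
  assert (Hx := locally_singleton _ _ Hi).
  generalize (filter_and _ _ Hi Hloc); apply filter_imp.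
  intros y [Hy Hyd].
  change (Rabs (minus (RInt (f y) a b) (RInt (f x) a b)) < eps).
  rewrite <- (RInt_minus (f y) (f x) a b Hy Hx).
  apply Rle_lt_trans with ((b - a) * (eps / (2 * (b - a + 1)))).
  - apply abs_RInt_le_const; [exact Hab | now apply @ex_RInt_minus |].
    intros t Ht. apply Rlt_le.
    apply (Hd t x t y); try lra.
    + assert (H := cond_pos d); lra.
    + apply Rabs_def2 in Hyd; lra.
    + rewrite Rminus_diag, Rabs_R0; apply cond_pos.
  - assert (He := cond_pos eps).
    apply Rmult_lt_reg_r with (2 * (b - a + 1)); [lra|].
    field_simplify; [nra | lra].
Qed.

Lemma continuous_RInt_param_gen (f : R -> R -> R) a b x :
  (forall t, Rmin a b <= t <= Rmax a b -> continuity_2d_pt f x t) ->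
  locally x (fun y => ex_RInt (f y) a b) ->
  continuous (fun y => RInt (f y) a b) x.
Proof.
  intros Hc Hi. destruct (Rle_dec a b) as [Hab|Hab].
  - apply continuous_RInt_param; auto.
    now rewrite Rmin_left, Rmax_right in Hc by lra.
  - apply continuous_ext_loc with (fun y => opp (RInt (f y) b a)).
    + revert Hi; apply filter_imp; intros y Hy.
      now apply opp_RInt_swap, ex_RInt_swap.
    + apply @continuous_opp, continuous_RInt_param; [lra | |].
      * now rewrite Rmin_right, Rmax_left in Hc by lra.
      * revert Hi; apply filter_imp; intros y; apply ex_RInt_swap.
Qed.

Lemma continuity_2d_swap (f : R -> R -> R) x y :
  continuity_2d_pt f x y -> continuity_2d_pt (fun u v => f v u) y x.
Proof.
  intros H e. destruct (H e) as [d Hd]. exists d; intros u v Hu Hv. now apply Hd.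
Qed.

Lemma ex_RInt_cont (g : R -> R) a b :
  (forall x, Rmin a b <= x <= Rmax a b -> continuous g x) -> ex_RInt g a b.
Proof. exact (ex_RInt_continuous g a b). Qed.

(* The substitution [t = x + s (b - x)] makes the bounds constant. *)
Lemma continuous_RInt_lower (p : R -> R -> R) lo hi b x :
  lo < x < hi ->
  (forall u t, lo < u < hi -> Rmin u b <= t <= Rmax u b ->
     continuity_2d_pt p u t) ->
  continuous (fun u => RInt (p u) u b) x.
Proof.
  intros Hx Hp.
  assert (Hin : forall u s, 0 <= s <= 1 -> Rmin u b <= u + s * (b - u) <= Rmax u b).
  { intros u s Hs. unfold Rmin, Rmax. destruct (Rle_dec u b); nra. }
  assert (Hc : forall u s, lo < u < hi -> 0 <= s <= 1 ->
    continuity_2d_pt (fun u s => (b - u) * p u (u + s * (b - u))) u s).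
  { intros u s Hu Hs.
    apply continuity_2d_pt_mult.
    - cont2d.
    - apply (continuity_2d_comp p (fun u _ => u) (fun u s => u + s * (b - u))).
      + apply Hp; [exact Hu | now apply Hin].
      + apply continuity_2d_pt_id1.
      + cont2d. }
  apply continuous_ext_loc with
    (fun u => RInt (fun s => (b - u) * p u (u + s * (b - u))) 0 1).
  - apply locally_interval with (a := Finite lo) (b := Finite hi); try apply Hx.
    simpl; intros u H1 H2.
    assert (E := RInt_comp_lin (p u) (b - u) u 0 1).
    replace ((b - u) * 0 + u) with u in E by ring.
    replace ((b - u) * 1 + u) with b in E by ring.
    rewrite <- E.
    + apply RInt_ext; intros s _. unfold scal; simpl.
      unfold mult; simpl. f_equal. f_equal. ring.
    + apply ex_RInt_cont. intros t Ht.
      apply continuity_2d_slice_r, Hp; [lra | exact Ht].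
  - apply continuous_RInt_param; [lra | |].
    + intros s Hs. now apply Hc.
    + apply locally_interval with (a := Finite lo) (b := Finite hi); try apply Hx.
      simpl; intros u H1 H2. apply ex_RInt_cont.
      intros s Hs. rewrite Rmin_left, Rmax_right in Hs by lra.
      apply continuity_2d_slice_r with (f := fun u s => (b - u) * p u (u + s * (b - u))).
      apply Hc; [lra | exact Hs].
Qed.

(** Leibniz rule when the parameter is also the lower bound: the moving bound contributes [- p x x].
    The hypotheses hold on an open strip around [x, b] because the bound moves to both sides of
    [x]. *)
Lemma is_derive_RInt_lower (p dp : R -> R -> R) x b (eps : posreal) :
  x <= b ->
  (forall u t, Rabs (u - x) < eps -> x - eps < t < b + eps ->
     is_derive (fun z => p z t) u (dp u t) /\ continuity_2d_pt dp u t
     /\ continuous (p u) t) ->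
  is_derive (fun u => RInt (p u) u b) x (RInt (dp x) x b - p x x).
Proof.
  intros Hxb H.
  assert (He := cond_pos eps).
  assert (Hx0 : Rabs (x - x) < eps) by (rewrite Rminus_diag, Rabs_R0; lra).
  assert (Hhalf : 0 < eps / 2) by lra.
  assert (Hloc : locally x (fun u => Rabs (u - x) < eps)) by (exists eps; auto).
  assert (HD : forall u t, Rabs (u - x) < eps -> x - eps < t < b + eps ->
    continuity_2d_pt (fun u v => Derive (fun z => p z v) u) u t).
  { intros u t Hu Ht.
    apply continuity_2d_pt_ext_loc with dp; [|now apply H].
    assert (Hd : 0 < Rmin (eps - Rabs (u - x)) (Rmin (t - (x - eps)) (b + eps - t))).
    { repeat apply Rmin_pos; lra. }
    exists (mkposreal _ Hd); simpl; intros u' t' Hu' Ht'.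
    symmetry; apply is_derive_unique, H.
    - replace (u' - x) with ((u' - u) + (u - x)) by ring.
      eapply Rle_lt_trans; [apply Rabs_triang|].
      assert (Hm := Rmin_l (eps - Rabs (u - x)) (Rmin (t - (x - eps)) (b + eps - t))).
      lra.
    - apply Rabs_def2 in Ht'.
      assert (Hm := Rmin_r (eps - Rabs (u - x)) (Rmin (t - (x - eps)) (b + eps - t))).
      assert (Hm1 := Rmin_l (t - (x - eps)) (b + eps - t)).
      assert (Hm2 := Rmin_r (t - (x - eps)) (b + eps - t)).
      lra. }
  replace (RInt (dp x) x b - p x x) with
    (RInt (fun t => Derive (fun u => p u t) x) x b + - p x x * 1).
  - apply (is_derive_RInt_param_bound_comp_aux2 p (fun u => u) b x 1).
    + revert Hloc; apply filter_imp; intros u Hu.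
      apply ex_RInt_cont; intros t Ht.
      rewrite Rmin_left, Rmax_right in Ht by lra. apply H; [exact Hu | lra].
    (* Half the radius keeps the closed interval around [x] inside the open strip. *)
    + exists (mkposreal _ Hhalf); simpl.
      revert Hloc; apply filter_imp; intros u Hu.
      apply ex_RInt_cont; intros t Ht.
      rewrite Rmin_left, Rmax_right in Ht by lra. apply H; [exact Hu | lra].
    + apply @is_derive_id.
    + exists (mkposreal _ Hhalf); simpl.
      revert Hloc; apply filter_imp; intros u Hu t Ht.
      exists (dp u t). apply H; [exact Hu|].
      unfold Rmin, Rmax in Ht.
      destruct (Rle_dec (x - eps / 2) b), (Rle_dec (x + eps / 2) b); lra.
    + intros t Ht. rewrite Rmin_left, Rmax_right in Ht by lra.
      apply HD; [exact Hx0 | lra].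
    + exists eps; intros u t Hu Ht. apply Rabs_def2 in Ht.
      apply HD; [exact Hu | lra].
    + apply continuous_pt, H; [exact Hx0 | lra].
  - rewrite Rmult_1_r. unfold Rminus. f_equal.
    apply RInt_ext; intros t Ht. rewrite Rmin_left, Rmax_right in Ht by lra.
    apply is_derive_unique, H; [exact Hx0 | lra].
Qed.

(** Fubini for a continuous integrand, by differentiation: as functions of the upper bound in [y],
    both sides vanish at [b0] and have the same derivative. The margins [lo] and [hi] give the end
    points the two-sided neighbourhoods that derivatives require. *)
Lemma RInt_exchange (F : R -> R -> R) a0 a1 lo hi b0 b1 :
  a0 <= a1 -> lo < b0 -> b0 <= b1 -> b1 < hi ->
  (forall x y, lo < y < hi -> continuity_2d_pt F x y) ->
  RInt (fun x => RInt (fun y => F x y) b0 b1) a0 a1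
  = RInt (fun y => RInt (fun x => F x y) a0 a1) b0 b1.
Proof.
  intros Ha Hlo Hb Hhi HF.
  assert (Hx : forall x y, lo < y < hi -> ex_RInt (F x) b0 y).
  { intros x y Hy. apply ex_RInt_cont; intros t Ht.
    apply continuity_2d_slice_r, HF.
    unfold Rmin, Rmax in Ht; destruct (Rle_dec b0 y); lra. }
  assert (Hy : forall y, lo < y < hi -> ex_RInt (fun x => F x y) a0 a1).
  { intros y Hy. apply ex_RInt_cont; intros t Ht.
    now apply continuity_2d_slice_l, HF. }
  assert (Hloc : forall y, lo < y < hi -> locally y (fun z => lo < z < hi)).
  { intros y Hy'. apply locally_interval with (a := Finite lo) (b := Finite hi);
    simpl; auto; apply Hy'. }
  assert (Hc : forall y, lo < y < hi -> continuous (fun z => RInt (fun x => F x z) a0 a1) y).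
  { intros y Hyy. apply (continuous_RInt_param (fun z x => F x z)); [exact Ha | |].
    - intros x _. now apply continuity_2d_swap, HF.
    - generalize (Hloc y Hyy); apply filter_imp; exact Hy. }
  set (D := fun b => RInt (fun x => RInt (fun y => F x y) b0 b) a0 a1
                     - RInt (fun y => RInt (fun x => F x y) a0 a1) b0 b).
  assert (HD : forall b, lo < b < hi -> is_derive D b 0).
  { intros b Hbb. unfold D.
    assert (Hder : forall x y, lo < y < hi ->
      is_derive (fun z => RInt (F x) b0 z) y (F x y)).
    { intros x y Hyy. apply (is_derive_RInt _ _ b0).
      - generalize (Hloc y Hyy); apply filter_imp; intros z Hz.
        now apply (RInt_correct (F x)), Hx.
      - now apply continuity_2d_slice_r, HF. }
    replace 0 with (minus (RInt (fun x => F x b) a0 a1) (RInt (fun x => F x b) a0 a1))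
      by (unfold minus, plus, opp; simpl; ring).
    apply @is_derive_minus.
    - replace (RInt (fun x => F x b) a0 a1)
        with (RInt (fun x => Derive (fun z => RInt (F x) b0 z) b) a0 a1)
        by (apply RInt_ext; intros; now apply is_derive_unique, Hder).
      apply (is_derive_RInt_param (fun z x => RInt (F x) b0 z)).
      + generalize (Hloc b Hbb); apply filter_imp; intros z Hz t _.
        exists (F t z). now apply Hder.
      + intros t _.
        apply continuity_2d_pt_ext_loc with (fun u v => F v u).
        * destruct (Hloc b Hbb) as [d Hd].
          exists d; intros u v Hu _. symmetry; apply is_derive_unique, Hder, Hd, Hu.
        * now apply continuity_2d_swap, HF.
      + generalize (Hloc b Hbb); apply filter_imp; intros z Hz.
        apply ex_RInt_cont; intros t _.
        apply (continuous_RInt_param_gen F).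
        * intros y Hyy. apply HF.
          unfold Rmin, Rmax in Hyy; destruct (Rle_dec b0 z); lra.
        * apply filter_forall; intros u. now apply Hx.
    - apply (is_derive_RInt (fun y => RInt (fun x => F x y) a0 a1) _ b0).
      + generalize (Hloc b Hbb); apply filter_imp; intros z Hz.
        apply (RInt_correct (fun y => RInt (fun x => F x y) a0 a1)), ex_RInt_cont.
        intros y Hyy. apply Hc.
        unfold Rmin, Rmax in Hyy; destruct (Rle_dec b0 z); lra.
      + now apply Hc. }
  assert (H0 : D b0 = 0).
  { unfold D. rewrite RInt_point.
    rewrite (RInt_ext _ (fun _ => 0)) by (intros x _; exact (RInt_point b0 (F x))).
    rewrite RInt_const. unfold scal, mult, zero; simpl. unfold mult; simpl. ring. }
  apply Rminus_diag_uniq. change (D b1 = 0). rewrite <- H0.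
  destruct Hb as [Hb | ->]; [|reflexivity].
  symmetry; apply eq_is_derive; [|exact Hb].
  intros t Ht. apply HD; lra.
Qed.

(** * Complex-valued functions of a real variable *)

Lemma C_eq (z w : C) : Re z = Re w -> Im z = Im w -> z = w.
Proof. destruct z, w; simpl; intros -> ->; reflexivity. Qed.

Lemma cis_plus a b : cis (a + b) = (cis a * cis b)%C.
Proof.
  apply C_eq; simpl; [rewrite cos_plus | rewrite sin_plus]; ring.
Qed.

Lemma cis_0 : cis 0 = 1%C.
Proof. unfold cis; now rewrite cos_0, sin_0. Qed.

Lemma cis_opp a : cis (- a) = Cconj (cis a).
Proof. unfold cis, Cconj; simpl; now rewrite cos_neg, sin_neg. Qed.

Lemma cis_pow a n : (cis a ^ n)%C = cis (INR n * a).
Proof.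
  induction n as [|n IH].
  - simpl. now rewrite Rmult_0_l, cis_0.
  - rewrite Cpow_S, IH, <- cis_plus, S_INR. f_equal; ring.
Qed.

Lemma cis_2PI_Z (k : Z) : cis (IZR k * (2 * PI)) = 1%C.
Proof.
  assert (H : forall n, cis (INR n * (2 * PI)) = 1%C).
  { intros n. rewrite <- cis_pow. unfold cis; rewrite cos_2PI, sin_2PI.
    apply Cpow_1_l. }
  destruct k as [|p|p].
  - now rewrite Rmult_0_l, cis_0.
  - rewrite <- (positive_nat_Z p), <- INR_IZR_INZ; apply H.
  - replace (IZR (Z.neg p)) with (- INR (Pos.to_nat p))
      by (rewrite INR_IZR_INZ, positive_nat_Z; symmetry; apply (Ropp_Ropp_IZR (Z.pos p))).
    rewrite Ropp_mult_distr_l_reverse, cis_opp, H.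
    apply C_eq; simpl; ring.
Qed.

(** Stated on real and imaginary parts because [C_integral] and [C_derivative] act componentwise;
    each complex fact then reduces to two real ones. *)
Definition Ccontinuous (g : R -> C) (t : R) : Prop :=
  continuous (fun s => Re (g s)) t /\ continuous (fun s => Im (g s)) t.

Definition Ccontinuous_2d (g : R -> R -> C) (x y : R) : Prop :=
  continuity_2d_pt (fun u v => Re (g u v)) x y
  /\ continuity_2d_pt (fun u v => Im (g u v)) x y.

Lemma Ccontinuous_const c t : Ccontinuous (fun _ => c) t.
Proof. split; apply continuous_const. Qed.

Lemma Ccontinuous_plus g h t :
  Ccontinuous g t -> Ccontinuous h t -> Ccontinuous (fun s => g s + h s)%C t.
Proof.
  intros [H1 H2] [H3 H4]; split.
  - exact (continuous_plus _ _ _ H1 H3).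
  - exact (continuous_plus _ _ _ H2 H4).
Qed.

Lemma Ccontinuous_minus g h t :
  Ccontinuous g t -> Ccontinuous h t -> Ccontinuous (fun s => g s - h s)%C t.
Proof.
  intros [H1 H2] [H3 H4]; split.
  - exact (continuous_minus _ _ _ H1 H3).
  - exact (continuous_minus _ _ _ H2 H4).
Qed.

Lemma Ccontinuous_mult g h t :
  Ccontinuous g t -> Ccontinuous h t -> Ccontinuous (fun s => g s * h s)%C t.
Proof.
  intros [H1 H2] [H3 H4]; split.
  - exact (continuous_minus _ _ _ (continuous_mult _ _ _ H1 H3)
      (continuous_mult _ _ _ H2 H4)).
  - exact (continuous_plus _ _ _ (continuous_mult _ _ _ H1 H4)
      (continuous_mult _ _ _ H2 H3)).
Qed.

Lemma Ccontinuous_RtoC (g : R -> R) t :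
  continuous g t -> Ccontinuous (fun s => RtoC (g s)) t.
Proof. intros H; split; [exact H | apply continuous_const]. Qed.

Lemma Ccontinuous_cis (g : R -> R) t :
  continuous g t -> Ccontinuous (fun s => cis (g s)) t.
Proof. intros H; split; [now apply continuous_cos_comp | now apply continuous_sin_comp]. Qed.

Lemma Ccontinuous_comp (g : R -> C) (u : R -> R) t :
  continuous u t -> Ccontinuous g (u t) -> Ccontinuous (fun s => g (u s)) t.
Proof.
  intros Hu [H1 H2]; split.
  - now apply (continuous_comp u (fun s => Re (g s))).
  - now apply (continuous_comp u (fun s => Im (g s))).
Qed.

Lemma Ccontinuous_ext_loc g h t :
  locally t (fun s => g s = h s) -> Ccontinuous g t -> Ccontinuous h t.
Proof.
  intros He [H1 H2]; split; eapply continuous_ext_loc.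
  2: exact H1. 3: exact H2.
  all: revert He; apply filter_imp; intros s ->; reflexivity.
Qed.

Lemma Ccontinuous_2d_const c x y : Ccontinuous_2d (fun _ _ => c) x y.
Proof. split; apply continuity_2d_pt_const. Qed.

Lemma Ccontinuous_2d_mult g h x y :
  Ccontinuous_2d g x y -> Ccontinuous_2d h x y ->
  Ccontinuous_2d (fun u v => g u v * h u v)%C x y.
Proof.
  intros [H1 H2] [H3 H4]; split; simpl.
  - now apply continuity_2d_pt_minus; apply continuity_2d_pt_mult.
  - now apply continuity_2d_pt_plus; apply continuity_2d_pt_mult.
Qed.

Lemma Ccontinuous_2d_plus g h x y :
  Ccontinuous_2d g x y -> Ccontinuous_2d h x y ->
  Ccontinuous_2d (fun u v => g u v + h u v)%C x y.
Proof.
  intros [H1 H2] [H3 H4]; split; simpl; now apply continuity_2d_pt_plus.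
Qed.

Lemma Ccontinuous_2d_RtoC (g : R -> R -> R) x y :
  continuity_2d_pt g x y -> Ccontinuous_2d (fun u v => RtoC (g u v)) x y.
Proof. intros H; split; [exact H | exact (continuity_2d_pt_const x y 0)]. Qed.

Lemma Ccontinuous_2d_comp1 (g : R -> C) (h : R -> R -> R) x y :
  Ccontinuous g (h x y) -> continuity_2d_pt h x y ->
  Ccontinuous_2d (fun u v => g (h u v)) x y.
Proof.
  intros [H1 H2] H; split.
  - apply (continuity_1d_2d_pt_comp (fun t => Re (g t))); auto; now apply continuous_pt.
  - apply (continuity_1d_2d_pt_comp (fun t => Im (g t))); auto; now apply continuous_pt.
Qed.

Lemma Ccontinuous_2d_comp (g : R -> R -> C) (h k : R -> R -> R) x y :
  Ccontinuous_2d g (h x y) (k x y) ->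
  continuity_2d_pt h x y -> continuity_2d_pt k x y ->
  Ccontinuous_2d (fun u v => g (h u v) (k u v)) x y.
Proof.
  intros [H1 H2] Hh Hk; split.
  - now apply (continuity_2d_comp (fun u v => Re (g u v))).
  - now apply (continuity_2d_comp (fun u v => Im (g u v))).
Qed.

Lemma Ccontinuous_2d_slice_l g x y :
  Ccontinuous_2d g x y -> Ccontinuous (fun u => g u y) x.
Proof.
  intros [H1 H2]; split.
  - exact (continuity_2d_slice_l _ _ _ H1).
  - exact (continuity_2d_slice_l _ _ _ H2).
Qed.

Lemma Ccontinuous_2d_slice_r g x y :
  Ccontinuous_2d g x y -> Ccontinuous (g x) y.
Proof.
  intros [H1 H2]; split.
  - exact (continuity_2d_slice_r _ _ _ H1).
  - exact (continuity_2d_slice_r _ _ _ H2).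
Qed.

(** * Integrals of complex-valued functions *)

Definition ex_C_integral (g : R -> C) (a b : R) : Prop :=
  ex_RInt (fun t => Re (g t)) a b /\ ex_RInt (fun t => Im (g t)) a b.

Lemma ex_C_integral_cont g a b :
  (forall t, Rmin a b <= t <= Rmax a b -> Ccontinuous g t) -> ex_C_integral g a b.
Proof.
  intros H; split; apply ex_RInt_cont; intros t Ht; now apply H.
Qed.

Lemma ex_C_integral_plus g h a b :
  ex_C_integral g a b -> ex_C_integral h a b ->
  ex_C_integral (fun t => g t + h t)%C a b.
Proof.
  intros [H1 H2] [H3 H4]; split.
  - exact (ex_RInt_plus _ _ _ _ H1 H3).
  - exact (ex_RInt_plus _ _ _ _ H2 H4).
Qed.

Lemma ex_C_integral_scal (c : C) g a b :
  ex_C_integral g a b -> ex_C_integral (fun t => c * g t)%C a b.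
Proof.
  intros [H1 H2]; split.
  - exact (ex_RInt_minus _ _ _ _ (ex_RInt_scal _ _ _ (Re c) H1)
      (ex_RInt_scal _ _ _ (Im c) H2)).
  - exact (ex_RInt_plus _ _ _ _ (ex_RInt_scal _ _ _ (Re c) H2)
      (ex_RInt_scal _ _ _ (Im c) H1)).
Qed.

Lemma C_integral_ext g h a b :
  (forall t, Rmin a b < t < Rmax a b -> g t = h t) ->
  C_integral g a b = C_integral h a b.
Proof.
  intros H; apply C_eq; simpl; apply RInt_ext; intros t Ht; now rewrite H.
Qed.

Lemma C_integral_plus g h a b :
  ex_C_integral g a b -> ex_C_integral h a b ->
  C_integral (fun t => g t + h t)%C a b = (C_integral g a b + C_integral h a b)%C.
Proof.
  intros [H1 H2] [H3 H4]; apply C_eq; simpl.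
  - exact (RInt_plus _ _ _ _ H1 H3).
  - exact (RInt_plus _ _ _ _ H2 H4).
Qed.

Lemma C_integral_scal (c : C) g a b :
  ex_C_integral g a b ->
  C_integral (fun t => c * g t)%C a b = (c * C_integral g a b)%C.
Proof.
  intros [H1 H2]; apply C_eq; simpl.
  - etransitivity.
    + exact (RInt_minus _ _ _ _ (ex_RInt_scal _ _ _ (Re c) H1)
        (ex_RInt_scal _ _ _ (Im c) H2)).
    + exact (f_equal2 minus (RInt_scal _ _ _ (Re c) H1) (RInt_scal _ _ _ (Im c) H2)).
  - etransitivity.
    + exact (RInt_plus _ _ _ _ (ex_RInt_scal _ _ _ (Re c) H2)
        (ex_RInt_scal _ _ _ (Im c) H1)).
    + exact (f_equal2 plus (RInt_scal _ _ _ (Re c) H2) (RInt_scal _ _ _ (Im c) H1)).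
Qed.

Lemma C_integral_minus g h a b :
  ex_C_integral g a b -> ex_C_integral h a b ->
  C_integral (fun t => g t - h t)%C a b = (C_integral g a b - C_integral h a b)%C.
Proof.
  intros [H1 H2] [H3 H4]; apply C_eq; simpl.
  - exact (RInt_minus _ _ _ _ H1 H3).
  - exact (RInt_minus _ _ _ _ H2 H4).
Qed.

Lemma C_integral_Chasles g a b c :
  ex_C_integral g a b -> ex_C_integral g b c ->
  (C_integral g a b + C_integral g b c)%C = C_integral g a c.
Proof.
  intros [H1 H2] [H3 H4]; apply C_eq; simpl.
  - exact (RInt_Chasles _ _ _ _ H1 H3).
  - exact (RInt_Chasles _ _ _ _ H2 H4).
Qed.

(** The two integrals differ by the pieces over [0, c] and [T, c + T], which are translates of each
    other by the period. *)
Lemma RInt_periodic_shift (g : R -> R) T c :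
  (forall t, continuous g t) -> (forall t, g (t + T) = g t) ->
  RInt (fun t => g (t + c)) 0 T = RInt g 0 T.
Proof.
  intros Hc Hp.
  assert (Hex : forall a b, ex_RInt g a b) by (intros; now apply ex_RInt_cont).
  assert (Hs : forall d a b, RInt (fun t => g (t + d)) a b = RInt g (a + d) (b + d)).
  { intros d a b.
    assert (E := RInt_comp_lin g 1 d a b).
    rewrite !Rmult_1_l in E. rewrite <- E by apply Hex.
    apply RInt_ext; intros t _. unfold scal; simpl; unfold mult; simpl.
    now rewrite !Rmult_1_l. }
  rewrite Hs.
  assert (E1 : RInt g (0 + T) (c + T) = RInt g 0 c).
  { rewrite <- Hs. apply RInt_ext; intros; apply Hp. }
  assert (E2 := RInt_Chasles g c 0 T (Hex _ _) (Hex _ _)).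
  assert (E3 := RInt_Chasles g c T (c + T) (Hex _ _) (Hex _ _)).
  assert (E4 := RInt_Chasles g 0 c 0 (Hex _ _) (Hex _ _)).
  rewrite RInt_point in E4.
  unfold plus, zero in *; simpl in *.
  rewrite Rplus_0_l in *. rewrite (Rplus_comm T c). lra.
Qed.

Lemma C_integral_periodic_shift (g : R -> C) T c :
  (forall t, Ccontinuous g t) -> (forall t, g (t + T) = g t) ->
  C_integral (fun t => g (t + c)) 0 T = C_integral g 0 T.
Proof.
  intros Hc Hp. apply C_eq; simpl.
  - apply (RInt_periodic_shift (fun t => Re (g t))); [apply Hc | intros t; now rewrite Hp].
  - apply (RInt_periodic_shift (fun t => Im (g t))); [apply Hc | intros t; now rewrite Hp].
Qed.

Lemma C_integral_exchange (F : R -> R -> C) a0 a1 lo hi b0 b1 :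
  a0 <= a1 -> lo < b0 -> b0 <= b1 -> b1 < hi ->
  (forall x y, lo < y < hi -> Ccontinuous_2d F x y) ->
  C_integral (fun x => C_integral (fun y => F x y) b0 b1) a0 a1
  = C_integral (fun y => C_integral (fun x => F x y) a0 a1) b0 b1.
Proof.
  intros Ha Hlo Hb Hhi HF. apply C_eq; simpl.
  - apply RInt_exchange with lo hi; auto; intros; now apply HF.
  - apply RInt_exchange with lo hi; auto; intros; now apply HF.
Qed.

Lemma Ccontinuous_integral_param (f : R -> R -> C) a b x :
  (forall t, Rmin a b <= t <= Rmax a b -> Ccontinuous_2d f x t) ->
  locally x (fun y => ex_C_integral (f y) a b) ->
  Ccontinuous (fun y => C_integral (f y) a b) x.
Proof.
  intros H Hi; split; simpl.
  - apply (continuous_RInt_param_gen (fun u v => Re (f u v))); [intros; now apply H|].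
    revert Hi; apply filter_imp; intros y Hy; apply Hy.
  - apply (continuous_RInt_param_gen (fun u v => Im (f u v))); [intros; now apply H|].
    revert Hi; apply filter_imp; intros y Hy; apply Hy.
Qed.

Lemma Ccontinuous_integral_lower (p : R -> R -> C) lo hi b x :
  lo < x < hi ->
  (forall u t, lo < u < hi -> Rmin u b <= t <= Rmax u b -> Ccontinuous_2d p u t) ->
  Ccontinuous (fun u => C_integral (p u) u b) x.
Proof.
  intros Hx Hp; split; simpl.
  - apply (continuous_RInt_lower (fun u v => Re (p u v)) lo hi); auto.
    intros; now apply Hp.
  - apply (continuous_RInt_lower (fun u v => Im (p u v)) lo hi); auto.
    intros; now apply Hp.
Qed.

(** * Derivatives and norms of complex-valued functions *)

Definition is_C_derivative (g : R -> C) (t : R) (l : C) : Prop :=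
  is_derive (fun s => Re (g s)) t (Re l) /\ is_derive (fun s => Im (g s)) t (Im l).

Lemma is_C_derivative_unique g t l : is_C_derivative g t l -> C_derivative g t = l.
Proof.
  intros [H1 H2]. apply C_eq; simpl; now apply is_derive_unique.
Qed.

Lemma is_C_derivative_ext_loc g h t l :
  locally t (fun s => g s = h s) -> is_C_derivative g t l -> is_C_derivative h t l.
Proof.
  intros He [H1 H2]; split; eapply is_derive_ext_loc.
  2: exact H1. 3: exact H2.
  all: revert He; apply filter_imp; intros s ->; reflexivity.
Qed.

Lemma is_C_derivative_scal (c : C) g t l :
  is_C_derivative g t l -> is_C_derivative (fun s => c * g s)%C t (c * l)%C.
Proof.
  intros [H1 H2]; split; simpl.
  - exact (is_derive_minus _ _ _ _ _ (is_derive_scal _ _ (Re c) _ H1)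
      (is_derive_scal _ _ (Im c) _ H2)).
  - exact (is_derive_plus _ _ _ _ _ (is_derive_scal _ _ (Re c) _ H2)
      (is_derive_scal _ _ (Im c) _ H1)).
Qed.

Lemma is_C_derivative_const_minus (c : C) g t l :
  is_C_derivative g t l -> is_C_derivative (fun s => c - g s)%C t (- l)%C.
Proof.
  intros [H1 H2]; split; simpl.
  - replace (- fst l) with (minus 0 (Re l)) by (unfold minus, plus, opp; simpl; unfold Re; ring).
    exact (is_derive_minus _ _ _ _ _ (is_derive_const (Re c) t) H1).
  - replace (- snd l) with (minus 0 (Im l)) by (unfold minus, plus, opp; simpl; unfold Im; ring).
    exact (is_derive_minus _ _ _ _ _ (is_derive_const (Im c) t) H2).
Qed.

Lemma is_C_derivative_integral_lower (p dp : R -> R -> C) x b (eps : posreal) :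
  x <= b ->
  (forall u t, Rabs (u - x) < eps -> x - eps < t < b + eps ->
     is_C_derivative (fun z => p z t) u (dp u t) /\ Ccontinuous_2d dp u t
     /\ Ccontinuous (p u) t) ->
  is_C_derivative (fun u => C_integral (p u) u b) x (C_integral (dp x) x b - p x x)%C.
Proof.
  intros Hxb H; split; simpl.
  - apply (is_derive_RInt_lower (fun u v => Re (p u v)) (fun u v => Re (dp u v)) x b eps Hxb).
    intros u t Hu Ht. destruct (H u t Hu Ht) as [[? ?] [[? ?] [? ?]]]; auto.
  - apply (is_derive_RInt_lower (fun u v => Im (p u v)) (fun u v => Im (dp u v)) x b eps Hxb).
    intros u t Hu Ht. destruct (H u t Hu Ht) as [[? ?] [[? ?] [? ?]]]; auto.
Qed.

(** This norm is used in place of the modulus: it is submultiplicative and bounds a componentwise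
    integral by bounding its two real integrals separately. *)
Definition Cnorm1 (z : C) : R := Rabs (Re z) + Rabs (Im z).

Lemma Cnorm1_mult z w : Cnorm1 (z * w)%C <= Cnorm1 z * Cnorm1 w.
Proof.
  unfold Cnorm1. rewrite re_mult, im_mult.
  assert (H1 := Rabs_triang (Re z * Re w) (- (Im z * Im w))).
  assert (H2 := Rabs_triang (Re z * Im w) (Im z * Re w)).
  rewrite Rabs_Ropp, !Rabs_mult in H1. rewrite !Rabs_mult in H2.
  unfold Rminus. lra.
Qed.

Lemma Cnorm1_pos z : 0 <= Cnorm1 z.
Proof. apply Rplus_le_le_0_compat; apply Rabs_pos. Qed.

Lemma Cnorm1_integral_le (g : R -> C) (phi : R -> R) a b :
  a <= b ->
  (forall t, a <= t <= b -> Ccontinuous g t) -> ex_RInt phi a b ->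
  (forall t, a <= t <= b -> Cnorm1 (g t) <= phi t) ->
  Cnorm1 (C_integral g a b) <= RInt phi a b.
Proof.
  intros Hab Hc Hphi Hle. unfold Cnorm1; simpl.
  assert (H1 : ex_RInt (fun t => Re (g t)) a b).
  { apply ex_RInt_cont. rewrite Rmin_left, Rmax_right by lra. intros; now apply Hc. }
  assert (H2 : ex_RInt (fun t => Im (g t)) a b).
  { apply ex_RInt_cont. rewrite Rmin_left, Rmax_right by lra. intros; now apply Hc. }
  assert (H3 := ex_RInt_norm _ _ _ H1). assert (H4 := ex_RInt_norm _ _ _ H2).
  eapply Rle_trans.
  - apply Rplus_le_compat; apply abs_RInt_le; assumption.
  - etransitivity; [apply Req_le; symmetry; exact (RInt_plus _ _ _ _ H3 H4)|].
    apply RInt_le; auto.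
    + exact (ex_RInt_plus _ _ _ _ H3 H4).
    + intros t Ht. apply Hle; lra.
Qed.

(** * Pointwise convergence of Fourier series *)

Lemma periodic_Z {V : Type} (u : R -> V) T :
  (forall t, u (t + T) = u t) -> forall (k : Z) t, u (t + IZR k * T) = u t.
Proof.
  intros H.
  assert (Hn : forall n t, u (t + INR n * T) = u t).
  { induction n as [|n IH]; intros t.
    - simpl. now rewrite Rmult_0_l, Rplus_0_r.
    - rewrite S_INR.
      replace (t + (INR n + 1) * T) with (t + INR n * T + T) by ring.
      now rewrite H. }
  intros k t. destruct (Z_le_gt_dec 0 k) as [Hk|Hk].
  - rewrite <- (Z2Nat.id k Hk), <- INR_IZR_INZ. apply Hn.
  - rewrite <- (Hn (Z.to_nat (- k)) (t + IZR k * T)) at 1.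
    f_equal. rewrite INR_IZR_INZ, Z2Nat.id, opp_IZR by lia. ring.
Qed.

(* Translating by half a period of the cosine changes the sign of the integral,
   so it is controlled by the modulus of continuity of [h]. *)
Lemma riemann_lebesgue (h : R -> R) phi :
  (forall t, continuous h t) -> (forall t, h (t + 2 * PI) = h t) ->
  is_lim_seq (fun n => RInt (fun t => h t * cos (INR n * t + phi)) 0 (2 * PI)) 0.
Proof.
  intros Hc Hp. apply is_lim_seq_spec; intros eps.
  assert (HPI := PI_RGT_0).
  assert (Heps : 0 < eps / (2 * PI)) by (apply Rdiv_lt_0_compat; [apply cond_pos | lra]).
  (* The interval contains [t + s] for every [t] in [0, 2 PI], since the shift [s] is at most PI. *)
  destruct (Heine_cor2 (f := h) (a := 0) (b := 3 * PI)
    (fun x _ => proj1 (continuous_pt h x) (Hc x)) (mkposreal _ Heps)) as [d Hd].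
  simpl in Hd.
  (* For n > N the half period PI / n of the cosine is smaller than [d]. *)
  destruct (nfloor_ex (PI / d)) as [N [_ HN]].
  { apply Rdiv_le_0_compat; [lra | apply cond_pos]. }
  exists (S N); intros n Hn.
  assert (Hdp := cond_pos d).
  assert (Hn1 : 1 <= INR n) by (apply (le_INR 1); lia).
  assert (HnN : PI / d < INR n).
  { apply Rlt_le_trans with (1 := HN). rewrite <- S_INR. now apply le_INR. }
  set (s := PI / INR n).
  assert (Hs : 0 < s < d).
  { split; [apply Rdiv_lt_0_compat; lra|].
    unfold s. apply Rmult_lt_reg_r with (INR n); [lra|].
    apply Rmult_lt_compat_r with (r := d) in HnN; [|exact Hdp].
    unfold Rdiv in *. rewrite Rmult_assoc, Rinv_l, Rmult_1_r in HnN by lra.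
    rewrite Rmult_assoc, Rinv_l, Rmult_1_r by lra. lra. }
  assert (Hs2 : s <= PI).
  { unfold s. apply Rmult_le_reg_r with (INR n); [lra|].
    unfold Rdiv. rewrite Rmult_assoc, Rinv_l, Rmult_1_r by lra. nra. }
  assert (Hcos : forall t, continuous (fun t => cos (INR n * t + phi)) t).
  { intros t. apply continuous_cos_comp.
    apply @continuous_plus; [apply @continuous_mult|];
      first [apply continuous_id | apply continuous_const]. }
  set (w := fun t => h t * cos (INR n * t + phi)).
  assert (Hw : forall t, continuous w t) by (intros; now apply @continuous_mult).
  assert (Hwp : forall t, w (t + 2 * PI) = w t).
  { intros t. unfold w. rewrite Hp. f_equal.
    rewrite <- (cos_period (INR n * t + phi) n). f_equal; ring. }
  assert (Hshift := RInt_periodic_shift w (2 * PI) s Hw Hwp).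
  assert (Hws : forall t, w (t + s) = - (h (t + s) * cos (INR n * t + phi))).
  { intros t. unfold w.
    replace (INR n * (t + s) + phi) with ((INR n * t + phi) + PI)
      by (unfold s; field; lra).
    rewrite neg_cos. ring. }
  assert (Hwc : forall t, continuous (fun t => w (t + s)) t).
  { intros t. apply (continuous_comp (fun t => t + s) w); [|apply Hw].
    apply @continuous_plus; [apply continuous_id | apply continuous_const]. }
  assert (E1 : ex_RInt w 0 (2 * PI)) by (apply ex_RInt_cont; auto).
  assert (E2 : ex_RInt (fun t => w (t + s)) 0 (2 * PI)) by (apply ex_RInt_cont; auto).
  (* By periodicity the sum is twice the integral to be bounded, while its integrand is a difference
     of nearby values of [h] times a cosine. *)
  assert (E := RInt_plus _ _ _ _ E1 E2).
  rewrite Hshift in E.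
  assert (B : Rabs (RInt (fun t => plus (w t) (w (t + s))) 0 (2 * PI))
              <= (2 * PI - 0) * (eps / (2 * PI))).
  { apply abs_RInt_le_const; [lra | exact (ex_RInt_plus _ _ _ _ E1 E2) |].
    intros t Ht. rewrite Hws. unfold w, plus; simpl.
    replace (h t * cos (INR n * t + phi) + - (h (t + s) * cos (INR n * t + phi)))
      with ((h t - h (t + s)) * cos (INR n * t + phi)) by ring.
    rewrite Rabs_mult.
    assert (H1 : Rabs (h t - h (t + s)) < eps / (2 * PI)).
    { apply Hd; try lra. rewrite Rabs_left; lra. }
    assert (H2 : Rabs (cos (INR n * t + phi)) <= 1) by (apply Rabs_le, COS_bound).
    assert (H3 := Rabs_pos (h t - h (t + s))).
    assert (H4 := Rabs_pos (cos (INR n * t + phi))).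
    nra. }
  apply (eq_ind _ (fun z => Rabs z <= _) B) in E. clear B; rename E into B.
  unfold plus in B; simpl in B.
  change (RInt (fun t => h t * cos (INR n * t + phi)) 0 (2 * PI)) with (RInt w 0 (2 * PI)).
  rewrite Rminus_0_r.
  replace (RInt w 0 (2 * PI) + RInt w 0 (2 * PI)) with (2 * RInt w 0 (2 * PI)) in B by ring.
  rewrite Rabs_mult, (Rabs_right 2) in B by lra.
  replace ((2 * PI - 0) * (eps / (2 * PI))) with (pos eps) in B by (field; lra).
  assert (H := cond_pos eps). lra.
Qed.

(** Continuous extension of u(t) / (2 sin(t/2)) when [u] has period 2 PI, u(0) = 0 and u'(0) = [l].
    Dividing by the real 2 sin(t/2) instead of exp(it) - 1 treats real and imaginary parts
    separately. The price is antiperiodicity, hence the factor cos(t/2) = 1 or -1 in the values at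
    the zeros. *)
Definition half_sine_quotient (u : R -> R) (l t : R) : R :=
  if Req_EM_T (sin (t / 2)) 0 then l * cos (t / 2) else u t / (2 * sin (t / 2)).

Lemma half_sine_quotient_shift u l t :
  (forall t, u (t + 2 * PI) = u t) ->
  half_sine_quotient u l (t + 2 * PI) = - half_sine_quotient u l t.
Proof.
  intros Hp. unfold half_sine_quotient.
  replace ((t + 2 * PI) / 2) with (t / 2 + PI) by field.
  rewrite neg_sin, neg_cos, Hp.
  destruct (Req_EM_T (- sin (t / 2)) 0), (Req_EM_T (sin (t / 2)) 0); try lra.
  field; lra.
Qed.

Lemma continuous_slope (u : R -> R) l :
  is_derive u 0 l -> u 0 = 0 ->
  continuous (fun t => if Req_EM_T t 0 then l else u t / t) 0.
Proof.
  intros Hd H0. apply is_derive_Reals in Hd.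
  apply continuous_pt. intros eps He.
  destruct (Hd eps He) as [d Hdd].
  exists d; split; [apply cond_pos|].
  intros t [[_ Hne] Ht]. simpl in *. unfold Rdist in *.
  rewrite Rminus_0_r in Ht.
  destruct (Req_EM_T 0 0) as [_|]; [|lra].
  destruct (Req_EM_T t 0) as [->|Hn]; [congruence|].
  specialize (Hdd t Hn Ht). now rewrite Rplus_0_l, H0, Rminus_0_r in Hdd.
Qed.

Lemma half_sine_quotient_continuous u l :
  (forall t, continuous u t) -> (forall t, u (t + 2 * PI) = u t) ->
  is_derive u 0 l -> u 0 = 0 ->
  forall t, continuous (half_sine_quotient u l) t.
Proof.
  intros Hc Hp Hd H0.
  assert (HPI := PI_RGT_0).
  assert (Hsin : forall t, continuous (fun t => 2 * sin (t / 2)) t).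
  { intros t. apply @continuous_mult; [apply continuous_const|].
    apply continuous_sin_comp, @continuous_mult;
      [apply continuous_id | apply continuous_const]. }
  assert (Hz : continuous (half_sine_quotient u l) 0).
  { assert (Hd2 : is_derive (fun t => 2 * sin (t / 2)) 0 1).
    { auto_derive; [trivial|]. rewrite Rmult_0_l, cos_0. field. }
    assert (Hs0 : 2 * sin (0 / 2) = 0).
    { replace (0 / 2) with 0 by field. rewrite sin_0. ring. }
    (* Near 0 the quotient is the slope of [u] divided by the slope of 2 sin(t/2), and the second
       slope tends to 1. *)
    assert (C1 := continuous_slope u l Hd H0).
    assert (C2 := continuous_slope (fun t => 2 * sin (t / 2)) 1 Hd2 Hs0).
    eapply continuous_ext_loc.
    2:{ apply @continuous_mult; [exact C1|].
        apply continuous_Rinv_comp; [exact C2|].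
        cbv beta; destruct (Req_EM_T 0 0); lra. }
    apply locally_interval with (a := Finite (- PI)) (b := Finite PI); simpl; try lra.
    intros t H1 H2. unfold half_sine_quotient. change mult with Rmult.
    destruct (Req_EM_T t 0) as [->|Hn].
    - replace (0 / 2) with 0 by field. rewrite sin_0, cos_0.
      destruct (Req_EM_T 0 0); lra.
    - assert (Hs : sin (t / 2) <> 0).
      { destruct (Rtotal_order t 0) as [Ht|[Ht|Ht]]; [|lra|].
        - apply Rlt_not_eq. replace (t / 2) with (- (- t / 2)) by field.
          rewrite sin_neg. assert (0 < sin (- t / 2)) by (apply sin_gt_0; lra). lra.
        - apply Rgt_not_eq, sin_gt_0; lra. }
      destruct (Req_EM_T (sin (t / 2)) 0); [contradiction|].
      field; auto. }
  intros t. destruct (Req_dec (sin (t / 2)) 0) as [Hs|Hs].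
  - destruct (sin_eq_0_0 _ Hs) as [k Hk].
    assert (Ht : t + IZR (- k) * (2 * PI) = 0).
    { rewrite opp_IZR. lra. }
    (* The square of the shift by [2 PI] leaves the sign unchanged. *)
    assert (Hper : forall t, half_sine_quotient u l (t + 4 * PI) = half_sine_quotient u l t).
    { intros s. replace (s + 4 * PI) with (s + 2 * PI + 2 * PI) by ring.
      rewrite !half_sine_quotient_shift by exact Hp. ring. }
    (* The zeros of sin(t/2) are multiples of 2 PI. Even multiples carry continuity at 0 over by a
       period 4 PI; odd ones take one more shift, which changes the sign. *)
    destruct (Zeven_odd_dec (- k)) as [He|Ho].
    + apply Zeven_ex in He. destruct He as [j Hj].
      apply continuous_ext with (fun s => half_sine_quotient u l (s + IZR j * (4 * PI))).
      { intros s. now apply periodic_Z. }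
      apply (continuous_comp (fun s => s + IZR j * (4 * PI)) (half_sine_quotient u l)).
      * apply @continuous_plus; [apply continuous_id | apply continuous_const].
      * rewrite Hj, mult_IZR in Ht.
        replace (t + IZR j * (4 * PI)) with 0 by lra. exact Hz.
    + apply Zodd_ex in Ho. destruct Ho as [j Hj].
      apply continuous_ext with
        (fun s => - half_sine_quotient u l (s + 2 * PI + IZR j * (4 * PI))).
      { intros s. rewrite (periodic_Z _ _ Hper), half_sine_quotient_shift by exact Hp.
        apply Ropp_involutive. }
      apply (continuous_opp (V := R_NormedModule)).
      apply (continuous_comp (fun s => s + 2 * PI + IZR j * (4 * PI)) (half_sine_quotient u l)).
      * repeat apply @continuous_plus; first [apply continuous_id | apply continuous_const].
      * rewrite Hj, plus_IZR, mult_IZR in Ht.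
        replace (t + 2 * PI + IZR j * (4 * PI)) with 0 by lra. exact Hz.
  - eapply continuous_ext_loc.
    2:{ apply @continuous_mult; [apply Hc|].
        apply continuous_Rinv_comp; [apply Hsin | lra]. }
    assert (Hne : locally t (fun s => 2 * sin (s / 2) <> 0)).
    { apply (Hsin t (fun y => y <> 0)). apply open_neq. lra. }
    revert Hne; apply filter_imp; intros s Hne.
    unfold half_sine_quotient. destruct (Req_EM_T (sin (s / 2)) 0); [lra|reflexivity].
Qed.

Lemma Series_telescope (a t : nat -> R) (l : R) :
  (forall j, a j = t j - t (S j)) -> is_lim_seq t l -> Series a = t 0%nat - l.
Proof.
  intros Ha Ht. apply is_series_unique.
  change (is_lim_seq (sum_n a) (t 0%nat - l)).
  apply is_lim_seq_ext with (fun n => t 0%nat - t (S n)).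
  - induction n as [|n IH].
    + now rewrite sum_O, Ha.
    + rewrite sum_Sn, <- IH, Ha. unfold plus; simpl. ring.
  - apply is_lim_seq_minus'; [apply is_lim_seq_const|].
    now apply -> is_lim_seq_incr_1.
Qed.

Lemma C_series_telescope (a t : nat -> C) :
  (forall j, a j = (t j - t (S j))%C) ->
  is_lim_seq (fun n => Re (t n)) 0 -> is_lim_seq (fun n => Im (t n)) 0 ->
  C_series a = t 0%nat.
Proof.
  intros Ha Hr Hi. apply C_eq; simpl.
  - rewrite (Series_telescope _ (fun n => Re (t n)) 0); [ring| |exact Hr].
    intros j; now rewrite Ha.
  - rewrite (Series_telescope _ (fun n => Im (t n)) 0); [ring| |exact Hi].
    intros j; now rewrite Ha.
Qed.

Lemma C_series_ext (a b : nat -> C) : (forall j, a j = b j) -> C_series a = C_series b.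
Proof. intros H; apply C_eq; simpl; apply Series_ext; intros j; now rewrite H. Qed.

(** * Fourier coefficients of periodic functions *)

Definition fourier_coef (g : R -> C) (n : Z) : C :=
  (RtoC (/ (2 * PI)) * C_integral (fun t => g t * cis (- IZR n * t)%R) 0 (2 * PI))%C.

Lemma Ccontinuous_character (w t : R) : Ccontinuous (fun s => cis (w * s)) t.
Proof.
  apply Ccontinuous_cis, @continuous_mult; [apply continuous_const | apply continuous_id].
Qed.

Lemma character_periodic (n : Z) t : cis (- IZR n * (t + 2 * PI)) = cis (- IZR n * t).
Proof.
  replace (- IZR n * (t + 2 * PI)) with (- IZR n * t + IZR (- n) * (2 * PI))
    by (rewrite opp_IZR; ring).
  rewrite cis_plus, cis_2PI_Z. ring.
Qed.

Lemma fourier_integrand_ex (g : R -> C) (n : Z) :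
  (forall t, Ccontinuous g t) ->
  ex_C_integral (fun t => g t * cis (- IZR n * t)%R)%C 0 (2 * PI).
Proof.
  intros Hg. apply ex_C_integral_cont; intros t _.
  apply Ccontinuous_mult; [apply Hg | apply Ccontinuous_character].
Qed.

Lemma fourier_coef_ext (g h : R -> C) n :
  (forall t, g t = h t) -> fourier_coef g n = fourier_coef h n.
Proof.
  intros H; unfold fourier_coef; f_equal; apply C_integral_ext; intros t _; now rewrite H.
Qed.

Lemma fourier_coef_plus (g h : R -> C) n :
  (forall t, Ccontinuous g t) -> (forall t, Ccontinuous h t) ->
  fourier_coef (fun t => g t + h t)%C n = (fourier_coef g n + fourier_coef h n)%C.
Proof.
  intros Hg Hh. unfold fourier_coef.
  rewrite <- Cmult_plus_distr_l, <- C_integral_plus by now apply fourier_integrand_ex.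
  f_equal. apply C_integral_ext; intros t _; ring.
Qed.

Lemma fourier_coef_scal (c : C) (g : R -> C) n :
  (forall t, Ccontinuous g t) ->
  fourier_coef (fun t => c * g t)%C n = (c * fourier_coef g n)%C.
Proof.
  intros Hg. unfold fourier_coef.
  transitivity (RtoC (/ (2 * PI)) *
    (c * C_integral (fun t => g t * cis (- IZR n * t)%R) 0 (2 * PI)))%C; [|ring].
  rewrite <- (C_integral_scal c) by now apply fourier_integrand_ex.
  f_equal. apply C_integral_ext; intros t _; ring.
Qed.

Lemma fourier_coef_translate (g : R -> C) (c : R) n :
  (forall t, Ccontinuous g t) -> (forall t, g (t + 2 * PI) = g t) ->
  fourier_coef (fun t => g (t + c)) n = (cis (IZR n * c) * fourier_coef g n)%C.
Proof.
  intros Hg Hp. unfold fourier_coef.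
  transitivity (RtoC (/ (2 * PI)) *
    (cis (IZR n * c)%R * C_integral (fun t => g t * cis (- IZR n * t)%R) 0 (2 * PI)))%C; [|ring].
  f_equal.
  rewrite <- (C_integral_periodic_shift
    (fun t => g t * cis (- IZR n * t)%R)%C (2 * PI) c).
  - rewrite <- (C_integral_scal (cis (IZR n * c))).
    + apply C_integral_ext; intros t _.
      replace (- IZR n * (t + c)) with (- IZR n * t + - (IZR n * c)) by ring.
      rewrite cis_plus.
      transitivity (g (t + c)%R * cis (- IZR n * t)%R *
        (cis (IZR n * c)%R * cis (- (IZR n * c))%R))%C; [|ring].
      rewrite <- cis_plus, Rplus_opp_r, cis_0. ring.
    + apply ex_C_integral_cont; intros t _.
      apply (Ccontinuous_comp (fun t => g t * cis (- IZR n * t)%R)%C (fun t => t + c)).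
      * apply @continuous_plus; [apply continuous_id | apply continuous_const].
      * apply Ccontinuous_mult; [apply Hg | apply Ccontinuous_character].
  - intros t; apply Ccontinuous_mult; [apply Hg | apply Ccontinuous_character].
  - intros t; now rewrite Hp, character_periodic.
Qed.

Lemma fourier_coef_const_0 (c : C) : fourier_coef (fun _ => c) 0 = c.
Proof.
  unfold fourier_coef.
  rewrite (C_integral_ext _ (fun _ => c)).
  - apply C_eq; unfold C_integral; rewrite !RInt_const; unfold scal; simpl;
      unfold mult; simpl; unfold Re, Im; field; apply PI_neq0.
  - intros t _. rewrite Ropp_0, Rmult_0_l, cis_0. ring.
Qed.

(** A constant is unchanged by the translation by PI / n, which multiplies its coefficient of index
    n by exp(i PI) = -1. *)
Lemma fourier_coef_const (c : C) n : (n <> 0)%Z -> fourier_coef (fun _ => c) n = 0%C.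
Proof.
  intros Hn.
  assert (Hn' : IZR n <> 0) by now apply not_0_IZR.
  assert (H := fourier_coef_translate (fun _ => c) (PI / IZR n) n
    (Ccontinuous_const c) (fun _ => eq_refl)).
  replace (IZR n * (PI / IZR n)) with PI in H by (field; exact Hn').
  replace (cis PI) with (RtoC (-1)) in H
    by (unfold cis; now rewrite cos_PI, sin_PI).
  set (w := fourier_coef _ n) in *.
  assert (H1 := f_equal Re H). assert (H2 := f_equal Im H).
  rewrite re_mult in H1. rewrite im_mult in H2. simpl in H1, H2.
  apply C_eq; unfold Re, Im in *; simpl in *; lra.
Qed.

Lemma fourier_coef_character_mult (h : R -> C) n :
  fourier_coef (fun t => cis t * h t)%C n = fourier_coef h (n - 1).
Proof.
  unfold fourier_coef. f_equal. apply C_integral_ext; intros t _.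
  replace (- IZR (n - 1) * t) with (t + - IZR n * t) by (rewrite minus_IZR; ring).
  rewrite cis_plus. ring.
Qed.

Lemma im_scal_l (r : R) (z : C) : Im (RtoC r * z) = r * Im z.
Proof. rewrite im_mult. simpl. ring. Qed.

Lemma lim_minus_0 (u v : nat -> R) :
  is_lim_seq u 0 -> is_lim_seq v 0 -> is_lim_seq (fun n => u n - v n) 0.
Proof.
  intros Hu Hv. rewrite <- (Rminus_0_r 0). now apply is_lim_seq_minus'.
Qed.

Lemma lim_plus_0 (u v : nat -> R) :
  is_lim_seq u 0 -> is_lim_seq v 0 -> is_lim_seq (fun n => u n + v n) 0.
Proof.
  intros Hu Hv. rewrite <- (Rplus_0_r 0). now apply is_lim_seq_plus'.
Qed.

Lemma fourier_coef_lim (h : R -> C) (s : Z) :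
  (s = 1 \/ s = -1)%Z ->
  (forall t, Ccontinuous h t) -> (forall t, h (t + 2 * PI) = h t) ->
  is_lim_seq (fun n => Re (fourier_coef h (s * Z.of_nat n))) 0
  /\ is_lim_seq (fun n => Im (fourier_coef h (s * Z.of_nat n))) 0.
Proof.
  intros Hs Hc Hp.
  (* As cos(x + s PI / 2) = - s sin x for s = 1 or -1, the phase allowed in [riemann_lebesgue]
     covers the sine integrals too. *)
  set (phi := IZR s * (PI / 2)).
  assert (Hcis : forall n t, cis (- IZR (s * Z.of_nat n) * t)
    = (cos (INR n * t + 0), cos (INR n * t + phi))).
  { intros n t. rewrite mult_IZR, <- INR_IZR_INZ, Rplus_0_r. unfold phi, cis.
    destruct Hs as [-> | ->].
    - replace (1 * (PI / 2)) with (PI / 2) by ring.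
      rewrite cos_plus, cos_PI2, sin_PI2.
      replace (- (1 * INR n) * t) with (- (INR n * t)) by ring.
      rewrite cos_neg, sin_neg. f_equal. ring.
    - replace (- (-1 * INR n) * t) with (INR n * t) by ring.
      replace (-1 * (PI / 2)) with (- (PI / 2)) by ring.
      rewrite cos_plus, cos_neg, sin_neg, cos_PI2, sin_PI2. f_equal. ring. }
  assert (Hre : forall t, continuous (fun t => Re (h t)) t) by apply Hc.
  assert (Him : forall t, continuous (fun t => Im (h t)) t) by apply Hc.
  assert (Pre : forall t, Re (h (t + 2 * PI)) = Re (h t)) by (intros; now rewrite Hp).
  assert (Pim : forall t, Im (h (t + 2 * PI)) = Im (h t)) by (intros; now rewrite Hp).
  assert (Hex : forall (u : R -> R) n psi, (forall t, continuous u t) ->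
    ex_RInt (fun t => u t * cos (INR n * t + psi)) 0 (2 * PI)).
  { intros u n psi Hu. apply ex_RInt_cont; intros t _.
    apply @continuous_mult; [apply Hu|].
    apply continuous_cos_comp, @continuous_plus; [apply @continuous_mult|];
      first [apply continuous_id | apply continuous_const]. }
  assert (Hlim : forall c u, is_lim_seq u 0 -> is_lim_seq (fun n => c * u n) 0).
  { intros c u Hu. replace (Finite 0) with (Rbar_mult c 0) by (simpl; f_equal; ring).
    now apply is_lim_seq_scal_l. }
  assert (L1 := fun psi => riemann_lebesgue _ psi Hre Pre).
  assert (L2 := fun psi => riemann_lebesgue _ psi Him Pim).
  split.
  - apply is_lim_seq_ext with (fun n => / (2 * PI) *
      (RInt (fun t => Re (h t) * cos (INR n * t + 0)) 0 (2 * PI)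
       - RInt (fun t => Im (h t) * cos (INR n * t + phi)) 0 (2 * PI))).
    + intros n. unfold fourier_coef. rewrite re_scal_l. f_equal.
      etransitivity; [symmetry; exact (RInt_minus _ _ _ _ (Hex _ n 0 Hre) (Hex _ n phi Him))|].
      refine (RInt_ext _ _ _ _ _); intros t _.
      cbv beta; rewrite Hcis, re_mult. reflexivity.
    + now apply Hlim, lim_minus_0.
  - apply is_lim_seq_ext with (fun n => / (2 * PI) *
      (RInt (fun t => Re (h t) * cos (INR n * t + phi)) 0 (2 * PI)
       + RInt (fun t => Im (h t) * cos (INR n * t + 0)) 0 (2 * PI))).
    + intros n. unfold fourier_coef. rewrite im_scal_l. f_equal.
      etransitivity; [symmetry; exact (RInt_plus _ _ _ _ (Hex _ n phi Hre) (Hex _ n 0 Him))|].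
      refine (RInt_ext _ _ _ _ _); intros t _.
      cbv beta; rewrite Hcis, im_mult. reflexivity.
    + now apply Hlim, lim_plus_0.
Qed.

Lemma cis_minus_1 t : (cis t - 1)%C = (2 * Ci * RtoC (sin (t / 2)) * cis (t / 2)%R)%C.
Proof.
  replace t with (2 * (t / 2)) at 1 by field.
  apply C_eq; simpl.
  - rewrite cos_2a_sin. ring.
  - rewrite sin_2a. ring.
Qed.

(* Writing [g t = (cis t - 1) * h t + g 0] makes the Fourier series of [g] at [0]
   telescope into the coefficients of [h]. *)
Lemma fourier_series_at_0 (g : R -> C) (l : C) :
  (forall t, Ccontinuous g t) -> (forall t, g (t + 2 * PI) = g t) ->
  is_C_derivative g 0 l ->
  (fourier_coef g 0 + C_series (fun j =>
     fourier_coef g (Z.of_nat (S j)) + fourier_coef g (- Z.of_nat (S j))))%C = g 0.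
Proof.
  intros Hc Hp [Hd1 Hd2].
  set (ur := fun t => Re (g t) - Re (g 0)).
  set (ui := fun t => Im (g t) - Im (g 0)).
  set (qr := half_sine_quotient ur (Re l)).
  set (qi := half_sine_quotient ui (Im l)).
  (* Since exp(it) - 1 = 2 i sin(t/2) exp(it/2), this is (g(t) - g(0)) / (exp(it) - 1). The quotient
     and exp(-it/2) both change sign under t + 2 PI, so [h] is periodic. *)
  set (h := fun t => ((qr t, qi t) * (- Ci) * cis (- / 2 * t)%R)%C).
  assert (Pur : forall t, ur (t + 2 * PI) = ur t) by (intros; unfold ur; now rewrite Hp).
  assert (Pui : forall t, ui (t + 2 * PI) = ui t) by (intros; unfold ui; now rewrite Hp).
  assert (Cq : forall t, Ccontinuous (fun t => (qr t, qi t)) t).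
  { assert (Hq : forall (u : R -> R) k, (forall t, continuous u t) ->
      (forall t, u (t + 2 * PI) = u t) -> is_derive u 0 k ->
      forall t, continuous (half_sine_quotient (fun t => u t - u 0) k) t).
    { intros u k Hu Hpu Hk t. apply half_sine_quotient_continuous.
      - intros s. apply @continuous_minus; [apply Hu | apply continuous_const].
      - intros s. now rewrite Hpu.
      - replace k with (minus k zero) by (unfold minus, plus, opp, zero; simpl; ring).
        apply @is_derive_minus; [exact Hk | apply @is_derive_const].
      - apply Rminus_diag. }
    intros t; split.
    - apply (Hq (fun t => Re (g t))); [apply Hc | | exact Hd1].
      intros; now rewrite Hp.
    - apply (Hq (fun t => Im (g t))); [apply Hc | | exact Hd2].
      intros; now rewrite Hp. }
  assert (Ch : forall t, Ccontinuous h t).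
  { intros t. apply Ccontinuous_mult; [apply Ccontinuous_mult|].
    - apply Cq.
    - apply Ccontinuous_const.
    - apply Ccontinuous_character. }
  assert (Ph : forall t, h (t + 2 * PI) = h t).
  { intros t. unfold h, qr, qi. rewrite !half_sine_quotient_shift by assumption.
    replace (- / 2 * (t + 2 * PI)) with (- / 2 * t + - PI) by field.
    rewrite cis_plus. unfold cis at 2. rewrite cos_neg, sin_neg, cos_PI, sin_PI.
    apply C_eq; simpl; ring. }
  assert (Hg : forall t, g t = (cis t * h t + -1 * h t + g 0%R)%C).
  { intros t. transitivity ((cis t - 1) * h t + g 0%R)%C; [|ring].
    rewrite cis_minus_1. unfold h.
    transitivity (RtoC (2 * sin (t / 2)) * (qr t, qi t)
      * (cis (t / 2)%R * cis (- / 2 * t)%R) + g 0%R)%C.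
    - rewrite <- cis_plus. replace (t / 2 + - / 2 * t) with 0 by field.
      rewrite cis_0. unfold qr, qi, half_sine_quotient.
      destruct (Req_EM_T (sin (t / 2)) 0) as [Hs|Hs].
      + destruct (sin_eq_0_0 _ Hs) as [k Hk].
        assert (Ht : g t = g 0).
        { rewrite <- (periodic_Z g _ Hp k 0). f_equal. lra. }
        rewrite Hs, Ht, Rmult_0_r. ring.
      + apply C_eq; simpl; unfold ur, ui, Re, Im; field; exact Hs.
    - transitivity ((- (Ci * Ci)) * (RtoC (2 * sin (t / 2)) * (qr t, qi t)
        * (cis (t / 2)%R * cis (- / 2 * t)%R)) + g 0%R)%C.
      + replace (- (Ci * Ci))%C with (RtoC 1); [ring|].
        apply C_eq; simpl; ring.
      + rewrite RtoC_mult. ring. }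
  assert (Hn : forall n, fourier_coef g n =
    (fourier_coef h (n - 1) - fourier_coef h n + fourier_coef (fun _ => g 0%R) n)%C).
  { intros n. rewrite (fourier_coef_ext _ _ n Hg).
    rewrite fourier_coef_plus, fourier_coef_plus, fourier_coef_scal,
      fourier_coef_character_mult; auto.
    - ring.
    - intros t. apply Ccontinuous_mult; [|apply Ch].
      apply Ccontinuous_cis, continuous_id.
    - intros t. apply Ccontinuous_mult; [apply Ccontinuous_const | apply Ch].
    - intros t. apply Ccontinuous_plus; apply Ccontinuous_mult; auto.
      + apply Ccontinuous_cis, continuous_id.
      + apply Ccontinuous_const.
    - intros t; apply Ccontinuous_const. }
  destruct (fourier_coef_lim h 1 (or_introl eq_refl) Ch Ph) as [L1 L2].
  destruct (fourier_coef_lim h (-1) (or_intror eq_refl) Ch Ph) as [L3 L4].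
  apply is_lim_seq_incr_1 in L3. apply is_lim_seq_incr_1 in L4.
  (* With h_n the coefficients of [h], that of [g] is h_(n-1) - h_n, plus g(0) if n = 0. The indices
     j + 1 and -(j + 1) together give t_j - t_(j+1) for t_j = h_j - h_(-j-1), and t_0 cancels h_(-1)
     - h_0 in the term of index 0. *)
  rewrite (C_series_telescope _ (fun j =>
    fourier_coef h (1 * Z.of_nat j) - fourier_coef h (-1 * Z.of_nat (S j)))%C).
  - rewrite Hn, fourier_coef_const_0. simpl. ring.
  - intros j. rewrite !Hn, !fourier_coef_const by lia.
    replace (Z.of_nat (S j) - 1)%Z with (1 * Z.of_nat j)%Z by lia.
    replace (1 * Z.of_nat (S j))%Z with (Z.of_nat (S j)) by lia.
    replace (-1 * Z.of_nat (S (S j)))%Z with (- Z.of_nat (S j) - 1)%Z by lia.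
    replace (-1 * Z.of_nat (S j))%Z with (- Z.of_nat (S j))%Z by lia.
    ring.
  - now apply lim_minus_0.
  - now apply lim_minus_0.
Qed.

(** Translation by [a] brings the point to 0 and multiplies the coefficient of index n by exp(ina),
    the power of [cis a] that appears in [fourier_sum]. *)
Lemma fourier_inversion (g : R -> C) (l : C) (a : R) :
  (forall t, Ccontinuous g t) -> (forall t, g (t + 2 * PI) = g t) ->
  is_C_derivative g a l ->
  fourier_sum (fourier_coef g) (cis a) = g a.
Proof.
  intros Hc Hp [Hd1 Hd2].
  assert (Hadd : forall t, continuous (fun t => t + a) t).
  { intros t. apply @continuous_plus; [apply continuous_id | apply continuous_const]. }
  assert (Hder : forall (u : R -> R) k, is_derive u a k -> is_derive (fun t => u (t + a)) 0 k).
  { intros u k Hu. replace k with (scal 1 k) by (unfold scal; simpl; unfold mult; simpl; ring).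
    apply (is_derive_comp u (fun t => t + a)).
    - now rewrite Rplus_0_l.
    - auto_derive; [trivial | ring]. }
  replace (g a) with (g (0 + a)) by (f_equal; ring).
  rewrite <- (fourier_series_at_0 (fun t => g (t + a)) l).
  - unfold fourier_sum. f_equal.
    + rewrite fourier_coef_translate by assumption.
      rewrite Rmult_0_l, cis_0. ring.
    + apply C_series_ext; intros j.
      rewrite !fourier_coef_translate by assumption.
      rewrite <- Cpow_conj, cis_pow, <- cis_opp, opp_IZR, <- INR_IZR_INZ.
      rewrite Ropp_mult_distr_l_reverse. f_equal; apply Cmult_comm.
  - intros t. now apply (Ccontinuous_comp g).
  - intros t. replace (t + 2 * PI + a) with (t + a + 2 * PI) by ring. apply Hp.
  - split.
    + now apply (Hder (fun t => Re (g t))).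
    + now apply (Hder (fun t => Im (g t))).
Qed.

(** * The kernel and the Neumann series *)

Lemma sin_acute theta : 0 < theta < PI / 2 -> 0 < sin theta < 1.
Proof.
  intros H. split; [apply sin_gt_0; lra|].
  rewrite <- sin_PI2. apply sin_increasing_1; lra.
Qed.

Lemma is_derive_asin x : -1 < x < 1 -> is_derive asin x (/ sqrt (1 - x ^ 2)).
Proof.
  intros Hx. apply is_derive_Reals.
  assert (H := derive_pt_asin x Hx).
  apply derive_pt_eq_1 in H.
  replace (/ sqrt (1 - x ^ 2)) with (1 / sqrt (1 - Rsqr x)); [exact H|].
  rewrite Rsqr_pow2. unfold Rdiv; ring.
Qed.

Lemma continuous_asin x : -1 < x < 1 -> continuous asin x.
Proof.
  intros Hx. apply (ex_derive_continuous (V := R_NormedModule)). eexists; now apply is_derive_asin.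
Qed.

(** For s = sin theta and tau = r / rho, the derivative of arc length with respect to radius along
    the second branch: the inverse cosine of the angle between branch and radius. *)
Definition exit_weight (s tau : R) : R := / sqrt (1 - (tau * s) ^ 2).

Definition kernel_phase (theta : R) (q n : Z) (tau : R) : R :=
  IZR n * (theta - asin (tau * sin theta)) - IZR q * theta.

(** The kernel is 1 - w exp(ib) with w' = s^2 tau w^3, b' = - n s w and s = sin theta, so its
    derivative is (- w' - i w b') exp(ib). *)
Definition kernel_derivative (theta : R) (q n : Z) (tau : R) : C :=
  (((- (sin theta ^ 2 * tau * exit_weight (sin theta) tau ^ 3))%R,
    (IZR n * sin theta * exit_weight (sin theta) tau ^ 2)%R)
   * cis (kernel_phase theta q n tau))%C.

Lemma sqrt_radicand_pos x : -1 < x < 1 -> 0 < 1 - x ^ 2.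
Proof. intros H. nra. Qed.

Lemma exit_weight_derive s tau :
  -1 < tau * s < 1 ->
  is_derive (exit_weight s) tau (s ^ 2 * tau * exit_weight s tau ^ 3).
Proof.
  intros H. assert (Hp := sqrt_radicand_pos _ H).
  assert (Hs := sqrt_lt_R0 _ Hp).
  unfold exit_weight. auto_derive.
  - simpl in *. split; [lra|]. split; [|trivial].
    apply Rgt_not_eq. unfold Rminus in Hs. exact Hs.
  - simpl in *. unfold Rminus in *. field. lra.
Qed.

Lemma exit_weight_continuous s tau :
  -1 < tau * s < 1 -> continuous (exit_weight s) tau.
Proof.
  intros H. apply (ex_derive_continuous (V := R_NormedModule)).
  eexists; now apply exit_weight_derive.
Qed.

Lemma kernel_phase_derive theta q n tau :
  -1 < tau * sin theta < 1 ->
  is_derive (kernel_phase theta q n) tau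
    (- (IZR n * sin theta * exit_weight (sin theta) tau)).
Proof.
  intros H.
  assert (Hlin : forall a da, is_derive a tau da ->
    is_derive (fun t => IZR n * (theta - a t) - IZR q * theta) tau (- (IZR n * da))).
  { intros a da Ha. auto_derive; [eexists; exact Ha|].
    rewrite (is_derive_unique (fun x : R => a x) _ _ Ha). ring. }
  rewrite Rmult_assoc. apply Hlin.
  apply (is_derive_comp asin (fun t => t * sin theta) tau
    (/ sqrt (1 - (tau * sin theta) ^ 2)) (sin theta)).
  - now apply is_derive_asin.
  - auto_derive; [trivial | ring].
Qed.

Lemma kernel_phase_continuous theta q n tau :
  -1 < tau * sin theta < 1 -> continuous (kernel_phase theta q n) tau.
Proof.
  intros H. apply (ex_derive_continuous (V := R_NormedModule)).
  eexists; now apply kernel_phase_derive.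
Qed.

Lemma kernel_is_C_derivative theta q n tau :
  -1 < tau * sin theta < 1 ->
  is_C_derivative (kernel theta q n) tau (kernel_derivative theta q n tau).
Proof.
  intros H.
  assert (Hw := exit_weight_derive _ _ H).
  assert (Hb := kernel_phase_derive theta q n tau H).
  set (w := exit_weight (sin theta)) in *. set (b := kernel_phase theta q n) in *.
  assert (E : forall t, kernel theta q n t = (1 - w t * cos (b t), - (w t * sin (b t)))).
  { intros t. unfold kernel. apply C_eq; simpl; unfold w, b, exit_weight, kernel_phase;
    simpl; ring. }
  split.
  - apply is_derive_ext with (fun t => 1 - w t * cos (b t)).
    { intros t; now rewrite E. }
    auto_derive.
    + repeat split; eexists; eassumption.
    + rewrite (is_derive_unique (fun x : R => w x) _ _ Hw),
        (is_derive_unique (fun x : R => b x) _ _ Hb). simpl.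
      fold w b. ring.
  - apply is_derive_ext with (fun t => - (w t * sin (b t))).
    { intros t; now rewrite E. }
    auto_derive.
    + repeat split; eexists; eassumption.
    + rewrite (is_derive_unique (fun x : R => w x) _ _ Hw),
        (is_derive_unique (fun x : R => b x) _ _ Hb). simpl.
      fold w b. ring.
Qed.

Lemma kernel_derivative_continuous theta q n tau :
  -1 < tau * sin theta < 1 -> Ccontinuous (kernel_derivative theta q n) tau.
Proof.
  intros H. apply Ccontinuous_mult.
  - assert (Hw := exit_weight_derive _ _ H).
    split; simpl; apply @ex_derive_continuous; auto_derive; repeat split;
      eexists; eassumption.
  - apply Ccontinuous_cis. now apply kernel_phase_continuous.
Qed.

Lemma kernel_C_derivative theta q n tau :
  -1 < tau * sin theta < 1 ->
  C_derivative (kernel theta q n) tau = kernel_derivative theta q n tau.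
Proof. intros H. now apply is_C_derivative_unique, kernel_is_C_derivative. Qed.

Lemma C_derivative_kernel_continuous theta q n tau :
  -1 < tau * sin theta < 1 -> Ccontinuous (C_derivative (kernel theta q n)) tau.
Proof.
  intros H. apply Ccontinuous_ext_loc with (kernel_derivative theta q n);
    [|now apply kernel_derivative_continuous].
  assert (Hl : continuous (fun t => t * sin theta) tau).
  { apply @continuous_mult; [apply continuous_id | apply continuous_const]. }
  assert (L : locally (tau * sin theta) (fun y => -1 < y < 1)).
  { apply locally_interval with (a := Finite (-1)) (b := Finite 1); simpl; auto; apply H. }
  assert (Ht : locally tau (fun t => -1 < t * sin theta < 1)) by exact (Hl _ L).
  revert Ht; apply filter_imp; intros t Ht.
  symmetry; now apply kernel_C_derivative.
Qed.

(* [w (1) cis (-q theta)] has modulus [1 / cos theta > 1]. *)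
Lemma kernel_1_neq0 theta q n : 0 < theta < PI / 2 -> kernel theta q n 1 <> 0%C.
Proof.
  intros H. assert (Hs := sin_acute _ H).
  unfold kernel. rewrite Rmult_1_l, asin_sin by lra.
  replace (IZR n * (theta - theta) - IZR q * theta) with (- IZR q * theta) by ring.
  assert (Hc : 0 < cos theta) by (apply cos_gt_0; lra).
  assert (Hc1 : cos theta < 1).
  { assert (E := sin2_cos2 theta). rewrite !Rsqr_pow2 in E. nra. }
  replace (sqrt (1 - sin theta ^ 2)) with (cos theta).
  2:{ symmetry. rewrite <- (sqrt_pow2 (cos theta)) by lra. f_equal.
      assert (E := sin2_cos2 theta). rewrite !Rsqr_pow2 in E. lra. }
  intros E. assert (E1 := f_equal Re E). simpl in E1.
  assert (B := COS_bound (- IZR q * theta)).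
  assert (E2 := f_equal Im E). simpl in E2.
  set (x := cos (- IZR q * theta)) in *. set (y := sin (- IZR q * theta)) in *.
  assert (P : x ^ 2 + y ^ 2 = 1).
  { assert (E3 := sin2_cos2 (- IZR q * theta)). rewrite !Rsqr_pow2 in E3.
    fold x y in E3. lra. }
  assert (Hi := Rinv_0_lt_compat _ Hc).
  assert (Ex : x = cos theta).
  { apply Rmult_eq_reg_l with (/ cos theta); [|lra]. rewrite Rinv_l by lra. lra. }
  assert (Ey : y = 0).
  { apply Rmult_eq_reg_l with (/ cos theta); [|lra]. lra. }
  rewrite Ex, Ey in P. nra.
Qed.

(** For u > Rad the integral from u to Rad runs over [Rad, u], and its smallest radius is Rad; the
    argument u / t * sin theta stays below 1 as long as u sin theta < Rad. This is the origin of the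
    bound [Rad / sin theta]. *)
Lemma sin_bound_ratio theta Rad u t :
  0 < theta < PI / 2 -> 0 < Rad -> 0 < u < Rad / sin theta ->
  Rmin u Rad <= t -> 0 < t /\ -1 < u / t * sin theta < 1.
Proof.
  intros H HR Hu Ht. assert (Hs := sin_acute _ H).
  assert (Hus : u * sin theta < Rad).
  { apply Rmult_lt_reg_r with (/ sin theta); [apply Rinv_0_lt_compat; lra|].
    rewrite Rmult_assoc, Rinv_r, Rmult_1_r by lra. apply Hu. }
  assert (Htp : 0 < t) by (unfold Rmin in Ht; destruct (Rle_dec u Rad); lra).
  assert (Hut : u * sin theta < t).
  { unfold Rmin in Ht; destruct (Rle_dec u Rad); nra. }
  assert (E : u / t * sin theta = u * sin theta / t) by (field; lra).
  split; [exact Htp|]. rewrite E. split.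
  - apply Rlt_trans with 0; [lra|]. apply Rdiv_lt_0_compat; nra.
  - apply Rmult_lt_reg_r with t; [exact Htp|].
    unfold Rdiv. rewrite Rmult_assoc, Rinv_l by lra. lra.
Qed.

(** * The Volterra operator and its iterates *)

Lemma ratio_continuous_2d u t : 0 < t -> continuity_2d_pt (fun u t => u / t) u t.
Proof.
  intros Ht. apply continuity_2d_pt_mult; [apply continuity_2d_pt_id1|].
  apply continuity_2d_pt_inv; [apply continuity_2d_pt_id2 | lra].
Qed.

Lemma volterra_integrand_continuous_2d theta q n (h : R -> C) u t :
  0 < t -> -1 < u / t * sin theta < 1 -> Ccontinuous h t ->
  Ccontinuous_2d (fun r rho =>
    h rho * C_derivative (kernel theta q n) (r / rho)%R * RtoC (/ rho))%C u t.
Proof.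
  intros Ht Hk Hh. repeat apply Ccontinuous_2d_mult.
  - apply Ccontinuous_2d_comp1; [exact Hh | apply continuity_2d_pt_id2].
  - apply (Ccontinuous_2d_comp1 (C_derivative (kernel theta q n)) (fun r rho => r / rho)).
    + now apply C_derivative_kernel_continuous.
    + now apply ratio_continuous_2d.
  - apply Ccontinuous_2d_RtoC, continuity_2d_pt_inv;
      [apply continuity_2d_pt_id2 | lra].
Qed.

Lemma Rad_lt_div_sin theta Rad : 0 < theta < PI / 2 -> 0 < Rad -> Rad < Rad / sin theta.
Proof.
  intros H HR. assert (Hs := sin_acute _ H).
  apply Rmult_lt_reg_r with (sin theta); [lra|].
  unfold Rdiv. rewrite Rmult_assoc, Rinv_l by lra. nra.
Qed.

(** The interval reaches beyond [Rad] so that it is preserved by iteration with two-sided continuity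
    at [Rad], the end point of every integral. *)
Lemma volterra_continuous Rad theta q n (h : R -> C) :
  0 < theta < PI / 2 -> 0 < Rad ->
  (forall t, 0 < t < Rad / sin theta -> Ccontinuous h t) ->
  forall r, 0 < r < Rad / sin theta -> Ccontinuous (volterra Rad theta q n h) r.
Proof.
  intros H HR Hh r Hr. assert (HRs := Rad_lt_div_sin _ _ H HR).
  unfold volterra. apply Ccontinuous_mult; [|apply Ccontinuous_const].
  apply (Ccontinuous_integral_lower (fun r rho =>
    h rho * C_derivative (kernel theta q n) (r / rho)%R * RtoC (/ rho))%C
    0 (Rad / sin theta)); [exact Hr|].
  intros u t Hu Ht.
  destruct (sin_bound_ratio theta Rad u t H HR Hu) as [Ht0 Hk]; [apply Ht|].
  apply volterra_integrand_continuous_2d; auto. apply Hh.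
  split; [exact Ht0|]. apply Rle_lt_trans with (1 := proj2 Ht).
  apply Rmax_lub_lt; [apply Hu | exact HRs].
Qed.

Lemma volterra_integrand_ex Rad theta q n (h : R -> C) r :
  0 < theta < PI / 2 -> 0 < r <= Rad ->
  (forall t, 0 < t < Rad / sin theta -> Ccontinuous h t) ->
  forall t, r <= t <= Rad -> Ccontinuous (fun rho =>
    h rho * C_derivative (kernel theta q n) (r / rho)%R * RtoC (/ rho))%C t.
Proof.
  intros H Hr Hh t Ht. assert (HRs := Rad_lt_div_sin theta Rad H ltac:(lra)).
  destruct (sin_bound_ratio theta Rad r t H) as [Ht0 Hk]; try lra.
  { rewrite Rmin_left; lra. }
  apply (Ccontinuous_2d_slice_r (fun r rho =>
    h rho * C_derivative (kernel theta q n) (r / rho)%R * RtoC (/ rho))%C).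
  apply volterra_integrand_continuous_2d; auto. apply Hh; lra.
Qed.

Lemma volterra_minus Rad theta q n (g h : R -> C) r :
  0 < theta < PI / 2 -> 0 < r < Rad ->
  (forall t, 0 < t < Rad / sin theta -> Ccontinuous g t) ->
  (forall t, 0 < t < Rad / sin theta -> Ccontinuous h t) ->
  volterra Rad theta q n (fun t => g t - h t)%C r
  = (volterra Rad theta q n g r - volterra Rad theta q n h r)%C.
Proof.
  intros H Hr Hg Hh. unfold volterra.
  transitivity ((C_integral (fun rho =>
      g rho * C_derivative (kernel theta q n) (r / rho)%R * RtoC (/ rho))%C r Rad
    - C_integral (fun rho =>
      h rho * C_derivative (kernel theta q n) (r / rho)%R * RtoC (/ rho))%C r Rad)
    / kernel theta q n 1)%C.
  - f_equal. rewrite <- C_integral_minus.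
    + apply C_integral_ext; intros t _; ring.
    + apply ex_C_integral_cont. rewrite Rmin_left, Rmax_right by lra.
      apply volterra_integrand_ex; auto; lra.
    + apply ex_C_integral_cont. rewrite Rmin_left, Rmax_right by lra.
      apply volterra_integrand_ex; auto; lra.
  - unfold Cdiv. ring.
Qed.

Lemma Cnorm1_continuous (g : R -> C) t :
  Ccontinuous g t -> continuity_pt (fun s => Cnorm1 (g s)) t.
Proof.
  intros [H1 H2]. apply continuous_pt.
  apply @continuous_plus; now apply continuous_Rabs_comp.
Qed.

Lemma Cnorm1_bounded (g : R -> C) a b :
  a <= b -> (forall t, a <= t <= b -> Ccontinuous g t) ->
  exists M, 0 <= M /\ forall t, a <= t <= b -> Cnorm1 (g t) <= M.
Proof.
  intros Hab H.
  destruct (continuity_ab_maj (fun s => Cnorm1 (g s)) a b Hab) as [x [Hx _]].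
  { intros t Ht. now apply Cnorm1_continuous, H. }
  exists (Cnorm1 (g x)); split; [apply Cnorm1_pos | exact Hx].
Qed.

Lemma is_RInt_reflected_pow A b r j :
  is_RInt (fun t => A * (b - t) ^ j) r b (A * (b - r) ^ S j / INR (S j)).
Proof.
  assert (HS : INR (S j) <> 0) by (apply not_0_INR; lia).
  replace (A * (b - r) ^ S j / INR (S j)) with
    (- (A * (b - b) ^ S j / INR (S j)) - - (A * (b - r) ^ S j / INR (S j))).
  2:{ rewrite Rminus_diag, pow_i by lia. field; exact HS. }
  refine (is_RInt_derive (fun t => - (A * (b - t) ^ S j / INR (S j)))
    (fun t => A * (b - t) ^ j) _ _ _ _).
  - intros t _. auto_derive; [trivial|].
    change (Nat.pred (S j)) with j.
    change (match j with O => 1 | S _ => INR j + 1 end) with (INR (S j)).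
    unfold Rminus. field. exact HS.
  - intros t _. apply (ex_derive_continuous (fun t => A * (b - t) ^ j)). auto_derive. trivial.
Qed.

(** Each iteration integrates (Rad - t)^j from r to Rad and so gains the factor (Rad - r) / (j + 1),
    which builds the factorial. The lower radius [r0] is there to bound 1 / rho. *)
Lemma volterra_iter_bound Rad theta q n (c : R -> C) r0 :
  0 < theta < PI / 2 -> 0 < r0 < Rad ->
  (forall t, 0 < t < Rad / sin theta -> Ccontinuous c t) ->
  exists M K, forall j r, r0 <= r <= Rad ->
    Cnorm1 (Nat.iter j (volterra Rad theta q n) c r)
    <= M * (K * (Rad - r)) ^ j / INR (fact j).
Proof.
  intros H Hr0 Hc. assert (Hs := sin_acute _ H).
  assert (HRs := Rad_lt_div_sin theta Rad H ltac:(lra)).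
  assert (Hit : forall j t, 0 < t < Rad / sin theta ->
    Ccontinuous (Nat.iter j (volterra Rad theta q n) c) t).
  { induction j as [|j IH]; [exact Hc|].
    intros t Ht. apply volterra_continuous; auto; lra. }
  destruct (Cnorm1_bounded c r0 Rad) as [M [HM HcM]]; [lra | intros; apply Hc; lra |].
  destruct (Cnorm1_bounded (C_derivative (kernel theta q n)) 0 1) as [L [HL HkL]]; [lra | |].
  { intros t Ht. apply C_derivative_kernel_continuous. nra. }
  set (N := Cnorm1 (/ kernel theta q n 1)).
  assert (HN : 0 <= N) by apply Cnorm1_pos.
  (* [L] bounds the derivative of the kernel on the ratios in [0, 1], [/ r0] bounds 1 / rho, and [N]
     is the norm of the inverse of the kernel at 1. *)
  exists M, (L * / r0 * N). set (K := L * / r0 * N).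
  induction j as [|j IH]; intros r Hr.
  - simpl. specialize (HcM r Hr). unfold Rdiv. rewrite Rinv_1. lra.
  - simpl Nat.iter. unfold volterra at 1, Cdiv.
    eapply Rle_trans; [apply Cnorm1_mult|]. fold N.
    assert (Hf : INR (fact j) > 0) by apply INR_fact_lt_0.
    set (A := M * K ^ j / INR (fact j) * (L * / r0)).
    assert (HI := is_RInt_reflected_pow A Rad r j).
    assert (B : Cnorm1 (C_integral (fun rho =>
        Nat.iter j (volterra Rad theta q n) c rho
        * C_derivative (kernel theta q n) (r / rho)%R * RtoC (/ rho))%C r Rad)
      <= RInt (fun t => A * (Rad - t) ^ j) r Rad).
    { apply Cnorm1_integral_le; [lra | | eexists; exact HI |].
      - apply volterra_integrand_ex; auto; lra.
      - intros t Ht.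
        assert (Hrt : 0 <= r / t <= 1).
        { split; [apply Rdiv_le_0_compat; lra|].
          apply Rmult_le_reg_r with t; [lra|].
          unfold Rdiv. rewrite Rmult_assoc, Rinv_l by lra. lra. }
        eapply Rle_trans; [apply Cnorm1_mult|].
        eapply Rle_trans; [apply Rmult_le_compat_r; [apply Cnorm1_pos | apply Cnorm1_mult]|].
        assert (B1 := IH t ltac:(lra)). assert (B2 := HkL _ Hrt).
        assert (B3 : Cnorm1 (RtoC (/ t)) <= / r0).
        { unfold Cnorm1; simpl. rewrite Rabs_R0, Rplus_0_r, Rabs_right.
          - apply Rinv_le_contravar; lra.
          - apply Rle_ge, Rlt_le, Rinv_0_lt_compat; lra. }
        replace (A * (Rad - t) ^ j) with
          ((M * (K * (Rad - t)) ^ j / INR (fact j)) * L * / r0)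
          by (unfold A; rewrite Rpow_mult_distr; unfold Rdiv; ring).
        apply Rmult_le_compat; try apply Cnorm1_pos; [| |exact B3].
        + apply Rmult_le_pos; apply Cnorm1_pos.
        + apply Rmult_le_compat; try apply Cnorm1_pos; assumption. }
    rewrite (is_RInt_unique _ _ _ _ HI) in B.
    eapply Rle_trans; [apply Rmult_le_compat_r; [exact HN | exact B]|].
    apply Req_le. unfold A. rewrite fact_simpl, mult_INR, !Rpow_mult_distr.
    replace (K ^ S j) with (L * / r0 * N * K ^ j) by reflexivity.
    assert (HS : INR (S j) <> 0) by (apply not_0_INR; lia).
    revert HS. generalize (INR (S j)); intros x HS.
    field. repeat split; lra.
Qed.

Lemma squeeze_abs (u v : nat -> R) :
  (forall n, Rabs (u n) <= v n) -> is_lim_seq v 0 -> is_lim_seq u 0.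
Proof.
  intros H Hv. apply is_lim_seq_le_le with (fun n => - v n) v.
  - intros n. specialize (H n). apply Rabs_le_between in H. lra.
  - replace (Finite 0) with (Rbar_opp 0) by (simpl; f_equal; ring).
    now apply -> is_lim_seq_opp.
  - exact Hv.
Qed.

(* With [t_j] the [j]-th iterate of [volterra] on [c], the Neumann terms are
   [t_j - t_(j+1)] and the series telescopes. *)
Lemma radial_coefficient_eq Rad theta G q n (c : R -> C) :
  0 < theta < PI / 2 -> 0 < Rad ->
  (forall t, 0 < t < Rad / sin theta -> Ccontinuous c t) ->
  (forall r, 0 < r < Rad ->
     (C_derivative (data_fourier Rad G q n) r / kernel theta q n 1)%C
     = (c r - volterra Rad theta q n c r)%C) ->
  forall r, 0 < r < Rad -> radial_coefficient Rad theta G q n r = c r.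
Proof.
  intros H HR Hc Heq r Hr.
  assert (HRs := Rad_lt_div_sin theta Rad H HR).
  set (T := fun j => Nat.iter j (volterra Rad theta q n) c).
  assert (Hit : forall j t, 0 < t < Rad / sin theta -> Ccontinuous (T j) t).
  { induction j as [|j IH]; [exact Hc|].
    intros t Ht. apply volterra_continuous; auto; lra. }
  assert (HT : forall j t, 0 < t < Rad ->
    neumann_term Rad theta G q n j t = (T j t - T (S j) t)%C).
  { induction j as [|j IH]; intros t Ht; [exact (Heq t Ht)|].
    change (T (S (S j)) t) with (volterra Rad theta q n (T (S j)) t).
    change (T (S j) t) with (volterra Rad theta q n (T j) t).
    rewrite <- volterra_minus by (auto; lra).
    simpl neumann_term. unfold volterra. f_equal. apply C_integral_ext.
    rewrite Rmin_left, Rmax_right by lra. intros s Hs. rewrite IH by lra. reflexivity. }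
  destruct (volterra_iter_bound Rad theta q n c r H Hr Hc) as [M [K HMK]].
  assert (Hlim : is_lim_seq (fun j => M * (K * (Rad - r)) ^ j / INR (fact j)) 0).
  { apply is_lim_seq_ext with (fun j => M * ((K * (Rad - r)) ^ j / INR (fact j))).
    { intros j; unfold Rdiv; ring. }
    replace (Finite 0) with (Rbar_mult M 0) by (simpl; f_equal; ring).
    apply is_lim_seq_scal_l. apply is_lim_seq_Reals, cv_speed_pow_fact. }
  unfold radial_coefficient. apply (C_series_telescope _ (fun j => T j r)).
  - intros j. now apply HT.
  - apply squeeze_abs with (2 := Hlim). intros j.
    eapply Rle_trans; [|apply HMK; lra]. unfold Cnorm1.
    assert (P := Rabs_pos (Im (Nat.iter j (volterra Rad theta q n) c r))).
    unfold T. lra.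
  - apply squeeze_abs with (2 := Hlim). intros j.
    eapply Rle_trans; [|apply HMK; lra]. unfold Cnorm1.
    assert (P := Rabs_pos (Re (Nat.iter j (volterra Rad theta q n) c r))).
    unfold T. lra.
Qed.

(** * Fourier modes of the V-line data *)

Lemma C_integral_comp (f : R -> C) (g dg : R -> R) a b :
  (forall x, Rmin a b <= x <= Rmax a b -> Ccontinuous f (g x)) ->
  (forall x, Rmin a b <= x <= Rmax a b -> is_derive g x (dg x) /\ continuous dg x) ->
  C_integral (fun y => RtoC (dg y) * f (g y))%C a b = C_integral f (g a) (g b).
Proof.
  intros Hf Hg. apply C_eq; simpl.
  - rewrite <- (RInt_comp (fun t => Re (f t)) g dg) by (auto; intros; now apply Hf).
    apply RInt_ext; intros t _. unfold scal; simpl; unfold mult; simpl. unfold Re. ring.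
  - rewrite <- (RInt_comp (fun t => Im (f t)) g dg) by (auto; intros; now apply Hf).
    apply RInt_ext; intros t _. unfold scal; simpl; unfold mult; simpl. unfold Im. ring.
Qed.

Definition value_at (F : R -> R -> C) (p : R * R) : C := F (fst p) (snd p).

(** Negative radii are meaningful here: the first branch lies on a line through the origin and
    crosses it at fixed [a]. *)
Definition polar (F : R -> R -> C) (a rho : R) : C := F (rho * cos a) (rho * sin a).

Definition circle_coef (F : R -> R -> C) (n : Z) (rho : R) : C :=
  fourier_coef (fun a => polar F a rho) n.

Lemma polar_continuous_2d F x y :
  (forall x y, Ccontinuous_2d F x y) -> Ccontinuous_2d (polar F) x y.
Proof.
  intros HF. unfold polar.
  apply (Ccontinuous_2d_comp F (fun a rho => rho * cos a) (fun a rho => rho * sin a)); auto.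
  - apply continuity_2d_pt_mult; [apply continuity_2d_pt_id2|].
    apply (continuous_2d_l cos), continuous_cos.
  - apply continuity_2d_pt_mult; [apply continuity_2d_pt_id2|].
    apply (continuous_2d_l sin), continuous_sin.
Qed.

Lemma polar_periodic F a rho : polar F (a + 2 * PI) rho = polar F a rho.
Proof.
  unfold polar. rewrite cos_plus, sin_plus, cos_2PI, sin_2PI. f_equal; ring.
Qed.

Lemma circle_coef_continuous F n rho :
  (forall x y, Ccontinuous_2d F x y) -> Ccontinuous (circle_coef F n) rho.
Proof.
  intros HF. unfold circle_coef, fourier_coef.
  apply Ccontinuous_mult; [apply Ccontinuous_const|].
  assert (H : forall rho a,
    Ccontinuous_2d (fun rho a => polar F a rho * cis (- IZR n * a)%R)%C rho a).
  { intros r a. apply Ccontinuous_2d_mult.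
    - apply (Ccontinuous_2d_comp (polar F) (fun _ a => a) (fun r _ => r)).
      + now apply polar_continuous_2d.
      + apply continuity_2d_pt_id2.
      + apply continuity_2d_pt_id1.
    - apply (Ccontinuous_2d_comp1 (fun a => cis (- IZR n * a)) (fun _ a => a)).
      + apply Ccontinuous_character.
      + apply continuity_2d_pt_id2. }
  apply (Ccontinuous_integral_param
    (fun rho a => polar F a rho * cis (- IZR n * a)%R)%C).
  - intros t _; apply H.
  - apply filter_forall; intros r. apply ex_C_integral_cont; intros t _.
    apply (Ccontinuous_2d_slice_r _ _ _ (H r t)).
Qed.

Lemma first_branch F Rad r phi :
  (forall x y, Ccontinuous_2d F x y) ->
  C_integral (fun s => value_at F (move (xpt Rad phi) s (udir phi))) 0 (Rad + r)
  = C_integral (polar F (phi + PI)) (- Rad) r.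
Proof.
  intros HF.
  (* With e the unit vector of angle phi + PI, the branch starts at - Rad e and has direction e, so
     s = rho + Rad. *)
  replace (C_integral (polar F (phi + PI)) (- Rad) r) with
    (C_integral (polar F (phi + PI)) (0 + - Rad) (Rad + r + - Rad)) by (f_equal; ring).
  rewrite <- (C_integral_comp _ (fun s => s + - Rad) (fun _ => 1)).
  - apply C_integral_ext; intros s _. unfold value_at, polar, move, xpt, udir; simpl.
    rewrite neg_cos, neg_sin, Cmult_1_l. f_equal; ring.
  - intros s _. exact (Ccontinuous_2d_slice_r _ _ _ (polar_continuous_2d F _ _ HF)).
  - intros s _. split; [auto_derive; [trivial | ring] | apply continuous_const].
Qed.

Lemma continuous_along_ray (g : R -> R -> R) (p u : R * R) s :
  (forall x y, continuity_2d_pt g x y) ->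
  continuous (fun s => g (fst (move p s u)) (snd (move p s u))) s.
Proof.
  intros Hg.
  assert (HL : forall k l, continuous (fun s => k + s * l) s).
  { intros k l. apply @continuous_plus; [apply continuous_const|].
    apply @continuous_mult; [apply continuous_id | apply continuous_const]. }
  apply (continuous_comp_2 (fun s => fst (move p s u)) (fun s => snd (move p s u)) g);
    try apply HL.
  now apply continuity_2d_pt_filterlim.
Qed.

(** The root s of s^2 + 2 r s cos theta + r^2 = rho^2: the length travelled from the vertex, at
    radius r, to the circle of radius rho. *)
Definition exit_distance (theta r rho : R) : R :=
  sqrt (rho ^ 2 - (r * sin theta) ^ 2) - r * cos theta.

Lemma ray_radicand theta r rho :
  0 < theta < PI / 2 -> 0 < r <= rho ->
  0 < rho ^ 2 - (r * sin theta) ^ 2 /\ 0 < r / rho * sin theta < 1.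
Proof.
  intros H Hr. assert (Hs := sin_acute _ H). split.
  - assert (r * sin theta < rho) by nra. assert (0 < r * sin theta) by nra. nra.
  - assert (E : r / rho * sin theta = r * sin theta / rho) by (field; lra).
    rewrite E. split; [apply Rdiv_lt_0_compat; nra|].
    apply Rmult_lt_reg_r with rho; [lra|].
    unfold Rdiv. rewrite Rmult_assoc, Rinv_l by lra. nra.
Qed.

Lemma sqrt_ray theta r rho :
  0 < theta < PI / 2 -> 0 < r <= rho ->
  sqrt (rho ^ 2 - (r * sin theta) ^ 2) = rho * sqrt (1 - (r / rho * sin theta) ^ 2).
Proof.
  intros H Hr. destruct (ray_radicand theta r rho H Hr) as [H1 H2].
  rewrite <- (sqrt_pow2 rho) at 2 by lra.
  rewrite <- sqrt_mult by nra. f_equal. field. lra.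
Qed.

(* The second branch meets the circle of radius [rho] at the polar angle
   [a + theta - asin (r sin theta / rho)], by the law of sines. *)
Lemma second_branch_point theta r rho phi :
  0 < theta < PI / 2 -> 0 < r <= rho ->
  let b := phi + PI + theta - asin (r / rho * sin theta) in
  (- r * cos phi - exit_distance theta r rho * cos (theta + phi),
   - r * sin phi - exit_distance theta r rho * sin (theta + phi))
  = (rho * cos b, rho * sin b).
Proof.
  intros H Hr b. destruct (ray_radicand theta r rho H Hr) as [H1 H2].
  unfold exit_distance. rewrite sqrt_ray by assumption.
  assert (Ea : sin (asin (r / rho * sin theta)) = r / rho * sin theta)
    by (apply sin_asin; lra).
  assert (Eb : cos (asin (r / rho * sin theta)) = sqrt (1 - (r / rho * sin theta) ^ 2)).
  { rewrite cos_asin by lra. now rewrite Rsqr_pow2. }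
  set (g := asin (r / rho * sin theta)) in *.
  rewrite <- Eb.
  assert (Hrs : r * sin theta = rho * sin g) by (rewrite Ea; field; lra).
  (* Both points are expanded along the direction of angle [c] and its normal; the terms in r cos
     theta cancel. *)
  set (c := theta + phi).
  assert (Hphi : phi = c - theta) by (unfold c; ring).
  assert (Hb : b = (c - g) + PI) by (unfold b, c; ring).
  rewrite Hb, neg_cos, neg_sin, Hphi, !cos_minus, !sin_minus.
  f_equal.
  - transitivity (- rho * cos g * cos c - r * sin theta * sin c); [ring|].
    rewrite Hrs. ring.
  - transitivity (- rho * cos g * sin c + r * sin theta * cos c); [ring|].
    rewrite Hrs. ring.
Qed.

(** Substitution of the radius for arc length, with Jacobian [exit_weight]; the branch is followed
    up to the circle of radius [Rad]. *)
Lemma second_branch F Rad theta r phi :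
  (forall x y, Ccontinuous_2d F x y) ->
  0 < theta < PI / 2 -> 0 < r < Rad ->
  C_integral (fun s => value_at F
      (move (move (xpt Rad phi) (Rad + r) (udir phi)) s (vdir theta phi)))
    0 (exit_distance theta r Rad)
  = C_integral (fun rho => RtoC (exit_weight (sin theta) (r / rho))
      * polar F (phi + PI + theta - asin (r / rho * sin theta)) rho)%C r Rad.
Proof.
  intros HF H Hr. assert (Hs := sin_acute _ H).
  (* At rho = r the square root equals r cos theta because the cosine is nonnegative. *)
  assert (H0 : exit_distance theta r r = 0).
  { unfold exit_distance.
    replace (r ^ 2 - (r * sin theta) ^ 2) with ((r * cos theta) ^ 2).
    - rewrite sqrt_pow2; [ring|]. apply Rmult_le_pos; [lra|].
      apply cos_ge_0; lra.
    - assert (S := sin2_cos2 theta). rewrite !Rsqr_pow2 in S.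
      replace (cos theta ^ 2) with (1 - sin theta ^ 2) by lra.
      rewrite !Rpow_mult_distr. replace (cos theta ^ 2) with (1 - sin theta ^ 2) by lra.
      ring. }
  rewrite <- H0 at 1.
  rewrite <- (C_integral_comp _ (exit_distance theta r)
    (fun rho => exit_weight (sin theta) (r / rho))).
  - apply C_integral_ext. rewrite Rmin_left, Rmax_right by lra.
    intros rho Hrho. f_equal. unfold value_at, polar, move, xpt, udir, vdir; simpl.
    assert (E := second_branch_point theta r rho phi H ltac:(lra)). simpl in E.
    injection E as E1 E2. rewrite <- E1, <- E2. f_equal; ring.
  - intros rho _. split.
    + apply (continuous_along_ray (fun x y => Re (F x y))); intros; apply HF.
    + apply (continuous_along_ray (fun x y => Im (F x y))); intros; apply HF.
  - rewrite Rmin_left, Rmax_right by lra. intros rho Hrho.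
    assert (Hr' : 0 < r <= rho) by lra.
    destruct (ray_radicand theta r rho H Hr') as [H1 H2].
    split.
    + unfold exit_distance. auto_derive; [simpl in H1; lra|].
      assert (E := sqrt_ray theta r rho H Hr').
      assert (P := sqrt_lt_R0 _ H1).
      unfold exit_weight. assert (P2 : 0 < 1 - (r / rho * sin theta) ^ 2).
      { apply sqrt_radicand_pos; lra. }
      apply sqrt_lt_R0 in P2.
      match goal with |- context [sqrt ?x] =>
        replace x with (rho ^ 2 - (r * sin theta) ^ 2) by (simpl; ring) end.
      rewrite E. simpl. simpl in P2. field. split; lra.
    + apply (continuous_comp (fun rho => r / rho) (exit_weight (sin theta))).
      * apply @continuous_mult; [apply continuous_const|].
        apply continuous_Rinv_comp; [apply continuous_id | lra].
      * apply exit_weight_continuous; lra.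
Qed.

(** The squared distance to the origin is (s + r cos theta)^2 + (r sin theta)^2, and the bound on
    [s] says that s + r cos theta is at least the square root of Rad^2 - (r sin theta)^2. *)
Lemma exit_distance_exits theta r Rad phi s :
  0 < theta < PI / 2 -> 0 < r < Rad -> exit_distance theta r Rad <= s ->
  let p := move (move (xpt Rad phi) (Rad + r) (udir phi)) s (vdir theta phi) in
  Rad ^ 2 <= fst p ^ 2 + snd p ^ 2.
Proof.
  intros H Hr Hs p.
  destruct (ray_radicand theta r Rad H ltac:(lra)) as [H1 _].
  unfold exit_distance in Hs.
  assert (E : fst p ^ 2 + snd p ^ 2 = (s + r * cos theta) ^ 2 + (r * sin theta) ^ 2).
  { unfold p, move, xpt, udir, vdir; simpl.
    assert (S1 := sin2_cos2 theta). assert (S2 := sin2_cos2 phi).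
    assert (S3 := sin2_cos2 (theta + phi)). unfold Rsqr in *.
    assert (D : cos (theta + phi) * cos phi + sin (theta + phi) * sin phi = cos theta).
    { rewrite <- cos_minus. f_equal; ring. }
    set (x := cos (theta + phi)) in *. set (y := sin (theta + phi)) in *.
    set (c := cos phi) in *. set (d := sin phi) in *.
    transitivity (r * r * (d * d + c * c) + 2 * r * s * (x * c + y * d)
      + s * s * (y * y + x * x)); [ring|].
    rewrite S2, S3, D.
    transitivity (r * r * (sin theta * sin theta + cos theta * cos theta)
      + 2 * r * s * cos theta + s * s); [rewrite S1; ring | ring]. }
  rewrite E.
  assert (Hq := sqrt_sqrt _ (Rlt_le _ _ H1)).
  assert (Hq0 := sqrt_pos (Rad ^ 2 - (r * sin theta) ^ 2)).
  set (z := sqrt _) in *. nra.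
Qed.

Lemma exit_distance_pos theta r Rad :
  0 < theta < PI / 2 -> 0 < r < Rad -> 0 <= exit_distance theta r Rad.
Proof.
  intros H Hr. unfold exit_distance.
  assert (Hc : 0 < cos theta) by (apply cos_gt_0; lra).
  assert (S := sin2_cos2 theta). rewrite !Rsqr_pow2 in S.
  assert (Hle : sqrt ((r * cos theta) ^ 2) <= sqrt (Rad ^ 2 - (r * sin theta) ^ 2)).
  { apply sqrt_le_1_alt. nra. }
  rewrite sqrt_pow2 in Hle by nra. lra.
Qed.

(** The interface between tensors and scalar analysis: [G] is a V-line transform of the scalar field
    [F] whose branches carry phases of weight [q] in their direction. Cutting the half-line at any
    [L] after which it stays outside the open disk replaces the improper integral by a proper
    one. *)
Definition spin_data (Rad theta : R) (q : Z) (F : R -> R -> C) (G : R -> R -> C) : Prop :=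
  forall phi d L, 0 <= phi < 2 * PI -> 0 <= d <= 2 * Rad -> 0 <= L ->
  (forall s, L <= s ->
     let p := move (move (xpt Rad phi) d (udir phi)) s (vdir theta phi) in
     Rad ^ 2 <= fst p ^ 2 + snd p ^ 2) ->
  G phi d =
    (cis (- IZR q * (phi + PI))%R *
       C_integral (fun s => value_at F (move (xpt Rad phi) s (udir phi))) 0 d
     + cis (- IZR q * (phi + PI + theta))%R *
       C_integral (fun s => value_at F
         (move (move (xpt Rad phi) d (udir phi)) s (vdir theta phi))) 0 L)%C.

(** * The Volterra equation of a Fourier mode *)

Lemma fourier_coef_shift_integral (g : R -> C) n c :
  (forall t, Ccontinuous g t) -> (forall t, g (t + 2 * PI) = g t) ->
  C_integral (fun t => g (t + c)%R * cis (- IZR n * (t + PI))%R)%C 0 (2 * PI)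
  = (RtoC (2 * PI) * (cis (IZR n * (c - PI))%R * fourier_coef g n))%C.
Proof.
  intros Hc Hp. assert (HPI := PI_RGT_0).
  (* The Fourier variable is the angle t + PI of the direction, so the net translation of [g] is c -
     PI. *)
  rewrite <- (fourier_coef_translate g (c - PI)) by assumption.
  set (h := fun t => g (t + (c - PI))).
  assert (Hh : forall t, Ccontinuous h t).
  { intros t. apply (Ccontinuous_comp g); [|apply Hc].
    apply @continuous_plus; [apply continuous_id | apply continuous_const]. }
  assert (Php : forall t, h (t + 2 * PI) = h t).
  { intros t. unfold h.
    replace (t + 2 * PI + (c - PI)) with (t + (c - PI) + 2 * PI) by ring. apply Hp. }
  unfold fourier_coef.
  rewrite Cmult_assoc, <- RtoC_mult, Rinv_r, Cmult_1_l by lra.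
  rewrite <- (C_integral_periodic_shift (fun t => h t * cis (- IZR n * t)%R)%C (2 * PI) PI).
  - apply C_integral_ext; intros t _. unfold h. do 2 f_equal. ring.
  - intros t. apply Ccontinuous_mult; [apply Hh | apply Ccontinuous_character].
  - intros t. now rewrite Php, character_periodic.
Qed.

(** The second branch contributes a spin phase, an arc-length density and the Fourier factor of an
    angular displacement. Their product is subtracted from 1 in [kernel] because the first branch is
    completed to the whole diameter when the data are differentiated. *)
Lemma kernel_factor theta q n tau :
  (cis (- IZR q * theta)%R * RtoC (exit_weight (sin theta) tau)
   * cis (IZR n * (theta - asin (tau * sin theta)))%R)%C = (1 - kernel theta q n tau)%C.
Proof.
  unfold kernel.
  replace (IZR n * (theta - asin (tau * sin theta)) - IZR q * theta)
    with (- IZR q * theta + IZR n * (theta - asin (tau * sin theta))) by ring.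
  rewrite cis_plus. unfold exit_weight. ring.
Qed.

Lemma data_fourier_eq Rad theta q n F G r :
  (forall x y, Ccontinuous_2d F x y) ->
  0 < theta < PI / 2 -> spin_data Rad theta q F G -> 0 < r < Rad ->
  data_fourier Rad G q n r =
    (C_integral (circle_coef F n) (- Rad) r
     + C_integral (fun rho => circle_coef F n rho * (1 - kernel theta q n (r / rho)%R))
         r Rad)%C.
Proof.
  intros HF H HG Hr. assert (HPI := PI_RGT_0). assert (Hs := sin_acute _ H).
  (* [f1] and [f2] are the branch integrands without spin phase. At fixed radius, integrating them
     over phi gives a Fourier coefficient on that circle, translated by a constant angle for
     [f2]. *)
  set (f1 := fun phi t => (polar F (phi + PI) t * cis (- IZR n * (phi + PI))%R)%C).
  set (f2 := fun phi rho => (RtoC (exit_weight (sin theta) (r / rho))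
    * polar F (phi + PI + theta - asin (r / rho * sin theta)) rho
    * cis (- IZR n * (phi + PI))%R)%C).
  assert (C1 : forall x y, Ccontinuous_2d f1 x y).
  { intros x y. apply Ccontinuous_2d_mult.
    - apply (Ccontinuous_2d_comp (polar F) (fun phi _ => phi + PI) (fun _ t => t)); cont2d.
      now apply polar_continuous_2d.
    - apply (Ccontinuous_2d_comp1 (fun a => cis (- IZR n * a)) (fun phi _ => phi + PI)); cont2d.
      apply Ccontinuous_character. }
  (* The exchange of integrals requires continuity on an open interval around [r, Rad]; the
     integrand is regular as soon as rho > r sin theta. *)
  assert (Hlo : r * sin theta < r) by nra.
  assert (Hrng : forall y, r * sin theta < y -> 0 < y /\ -1 < r / y * sin theta < 1).
  { intros y Hy. assert (0 < y) by nra. split; [assumption|].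
    replace (r / y * sin theta) with (r * sin theta / y) by (field; lra).
    split.
    - apply Rlt_trans with 0; [lra|]. apply Rdiv_lt_0_compat; nra.
    - apply Rmult_lt_reg_r with y; [lra|].
      unfold Rdiv. rewrite Rmult_assoc, Rinv_l by lra. lra. }
  assert (C3 : forall x y, r * sin theta < y < Rad + 1 -> Ccontinuous_2d (fun phi rho =>
    RtoC (exit_weight (sin theta) (r / rho))
    * polar F (phi + PI + theta - asin (r / rho * sin theta)) rho)%C x y).
  { intros x y Hy. destruct (Hrng y (proj1 Hy)) as [Hy0 Hk].
    assert (Cq : continuity_2d_pt (fun _ v => r / v) x y).
    { apply continuity_2d_pt_mult; [apply continuity_2d_pt_const|].
      apply continuity_2d_pt_inv; [apply continuity_2d_pt_id2 | lra]. }
    apply Ccontinuous_2d_mult.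
    - apply Ccontinuous_2d_RtoC.
      apply (continuity_1d_2d_pt_comp (exit_weight (sin theta)) (fun _ v => r / v)); [|exact Cq].
      now apply continuous_pt, exit_weight_continuous.
    - apply (Ccontinuous_2d_comp (polar F)
        (fun phi rho => phi + PI + theta - asin (r / rho * sin theta)) (fun _ t => t)).
      + now apply polar_continuous_2d.
      + apply continuity_2d_pt_minus; [cont2d|].
        apply (continuity_1d_2d_pt_comp asin (fun _ v => r / v * sin theta)).
        * now apply continuous_pt, continuous_asin.
        * apply continuity_2d_pt_mult; [exact Cq | apply continuity_2d_pt_const].
      + apply continuity_2d_pt_id2. }
  assert (C2 : forall x y, r * sin theta < y < Rad + 1 -> Ccontinuous_2d f2 x y).
  { intros x y Hy. apply Ccontinuous_2d_mult; [now apply C3|].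
    apply (Ccontinuous_2d_comp1 (fun a => cis (- IZR n * a)) (fun phi _ => phi + PI)); cont2d.
      apply Ccontinuous_character. }
  assert (Hpc : forall rho t, Ccontinuous (fun a => polar F a rho) t).
  { intros rho t. exact (Ccontinuous_2d_slice_l _ _ _ (polar_continuous_2d F _ _ HF)). }
  assert (Hpp : forall rho t, polar F (t + 2 * PI) rho = polar F t rho)
    by (intros; apply polar_periodic).
  set (A := C_integral (fun phi => C_integral (f1 phi) (- Rad) r) 0 (2 * PI)).
  set (B := C_integral (fun phi => C_integral (f2 phi) r Rad) 0 (2 * PI)).
  assert (EA : A = (RtoC (2 * PI) * C_integral (circle_coef F n) (- Rad) r)%C).
  { unfold A. rewrite (C_integral_exchange f1 0 (2 * PI) (- Rad - 1) (r + 1)) by (auto; lra).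
    rewrite <- C_integral_scal.
    - apply C_integral_ext; intros t _. unfold f1.
      rewrite (fourier_coef_shift_integral (fun a => polar F a t)) by auto.
      rewrite Rminus_diag, Rmult_0_r, cis_0, Cmult_1_l. reflexivity.
    - apply ex_C_integral_cont; intros t _. now apply circle_coef_continuous. }
  assert (EB : (cis (- IZR q * theta)%R * B)%C = (RtoC (2 * PI) * C_integral
    (fun rho => circle_coef F n rho * (1 - kernel theta q n (r / rho)%R)) r Rad)%C).
  { unfold B.
    rewrite (C_integral_exchange f2 0 (2 * PI) (r * sin theta) (Rad + 1)) by (auto; lra).
    rewrite <- (C_integral_scal (cis (- IZR q * theta))), <- C_integral_scal.
    - apply C_integral_ext. rewrite Rmin_left, Rmax_right by lra. intros rho Hrho.
      set (w := exit_weight (sin theta) (r / rho)).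
      set (b := theta - asin (r / rho * sin theta)).
      assert (E : C_integral (fun phi => f2 phi rho) 0 (2 * PI)
        = (RtoC w * (RtoC (2 * PI) * (cis (IZR n * b)%R * circle_coef F n rho)))%C).
      { unfold circle_coef. replace b with (PI + b - PI) by ring.
        rewrite <- (fourier_coef_shift_integral (fun a => polar F a rho)) by auto.
        rewrite <- (C_integral_scal w).
        - apply C_integral_ext; intros phi _. unfold f2. fold w.
          replace (phi + PI + theta - asin (r / rho * sin theta)) with (phi + (PI + b))
            by (unfold b; ring). ring.
        - apply ex_C_integral_cont; intros t _. apply Ccontinuous_mult.
          + apply (Ccontinuous_comp (fun a => polar F a rho)); [|apply Hpc].
            apply @continuous_plus; [apply continuous_id | apply continuous_const].
          + apply (Ccontinuous_comp (fun a => cis (- IZR n * a)) (fun t => t + PI)).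
            * apply @continuous_plus; [apply continuous_id | apply continuous_const].
            * apply Ccontinuous_character. }
      rewrite E, <- kernel_factor. fold w b. ring.
    - apply ex_C_integral_cont. rewrite Rmin_left, Rmax_right by lra. intros t Ht.
      apply Ccontinuous_mult; [now apply circle_coef_continuous|].
      apply Ccontinuous_minus; [apply Ccontinuous_const|].
      destruct (Hrng t ltac:(lra)) as [Ht0 Hk].
      apply (Ccontinuous_comp (kernel theta q n) (fun t => r / t)).
      + apply @continuous_mult; [apply continuous_const|].
        apply continuous_Rinv_comp; [apply continuous_id | lra].
      + destruct (kernel_is_C_derivative theta q n _ Hk) as [D1 D2].
        split; apply (ex_derive_continuous (V := R_NormedModule)); eexists; eassumption.
    - apply ex_C_integral_cont; intros t Ht. rewrite Rmin_left, Rmax_right in Ht by lra.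
      apply (Ccontinuous_integral_param (fun rho phi => f2 phi rho)).
      + intros x _. destruct (C2 x t ltac:(lra)) as [D1 D2].
        split; now apply continuity_2d_swap in D1, D2.
      + apply locally_interval with (a := Finite (r * sin theta)) (b := Finite (Rad + 1));
          simpl; try lra.
        intros y H1 H2. apply ex_C_integral_cont; intros x _.
        apply (Ccontinuous_2d_slice_l _ _ _ (C2 x y (conj H1 H2))). }
  assert (Hex1 : ex_C_integral (fun phi => C_integral (f1 phi) (- Rad) r) 0 (2 * PI)).
  { apply ex_C_integral_cont; intros phi _. apply Ccontinuous_integral_param.
    - intros t _; apply C1.
    - apply filter_forall; intros y. apply ex_C_integral_cont; intros t _.
      apply (Ccontinuous_2d_slice_r _ _ _ (C1 y t)). }
  assert (Hex2 : ex_C_integral (fun phi => C_integral (f2 phi) r Rad) 0 (2 * PI)).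
  { apply ex_C_integral_cont; intros phi _. apply Ccontinuous_integral_param.
    - intros t Ht. rewrite Rmin_left, Rmax_right in Ht by lra. apply C2; lra.
    - apply filter_forall; intros y. apply ex_C_integral_cont; intros t Ht.
      rewrite Rmin_left, Rmax_right in Ht by lra.
      apply (Ccontinuous_2d_slice_r _ _ _ (C2 y t ltac:(lra))). }
  assert (E : data_fourier Rad G q n r
    = (RtoC (/ (2 * PI)) * (A + cis (- IZR q * theta)%R * B))%C).
  { unfold data_fourier. f_equal. unfold A, B.
    rewrite <- C_integral_scal, <- C_integral_plus by (auto; now apply ex_C_integral_scal).
    apply C_integral_ext. rewrite Rmin_left, Rmax_right by lra. intros phi Hphi.
    rewrite (HG phi (Rad + r) (exit_distance theta r Rad)); try lra.
    - rewrite (first_branch F Rad r phi HF).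
      rewrite (second_branch F Rad theta r phi HF H Hr).
      set (I1 := C_integral (polar F (phi + PI)) (- Rad) r).
      set (I2 := C_integral _ r Rad).
      assert (E1 : C_integral (f1 phi) (- Rad) r = (cis (- IZR n * (phi + PI))%R * I1)%C).
      { unfold I1. rewrite <- C_integral_scal.
        - apply C_integral_ext; intros t _. unfold f1. ring.
        - apply ex_C_integral_cont; intros t _.
          exact (Ccontinuous_2d_slice_r _ _ _ (polar_continuous_2d F _ _ HF)). }
      assert (E2 : C_integral (f2 phi) r Rad = (cis (- IZR n * (phi + PI))%R * I2)%C).
      { unfold I2. rewrite <- C_integral_scal.
        - apply C_integral_ext; intros t _. unfold f2. ring.
        - apply ex_C_integral_cont; intros t Ht. rewrite Rmin_left, Rmax_right in Ht by lra.
          exact (Ccontinuous_2d_slice_r _ _ _ (C3 phi t ltac:(lra))). }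
      rewrite E1, E2, minus_IZR.
      replace (- IZR q * (phi + PI + theta)) with (- IZR q * (phi + PI) + - IZR q * theta) by ring.
      replace ((IZR q - IZR n) * (phi + PI))
        with (IZR q * (phi + PI) + - IZR n * (phi + PI)) by ring.
      rewrite !cis_plus.
      (* The weight exp(iqa) in [data_fourier] undoes the phase common to both branches; exp(-iq
         theta) remains on the second. *)
      transitivity ((cis (- IZR q * (phi + PI))%R * cis (IZR q * (phi + PI))%R)
        * (cis (- IZR n * (phi + PI))%R * I1
           + cis (- IZR q * theta)%R * (cis (- IZR n * (phi + PI))%R * I2)))%C; [ring|].
      rewrite <- cis_plus.
      replace (- IZR q * (phi + PI) + IZR q * (phi + PI)) with 0 by ring.
      rewrite cis_0. ring.
    - now apply exit_distance_pos.
    - intros s Hs'. now apply exit_distance_exits. }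
  rewrite E, EA, EB, <- Cmult_plus_distr_l, Cmult_assoc, <- RtoC_mult, Rinv_l by lra.
  apply Cmult_1_l.
Qed.

Lemma circle_coef_volterra Rad theta q n F G r :
  (forall x y, Ccontinuous_2d F x y) ->
  0 < theta < PI / 2 -> spin_data Rad theta q F G -> 0 < r < Rad ->
  (C_derivative (data_fourier Rad G q n) r / kernel theta q n 1)%C
  = (circle_coef F n r - volterra Rad theta q n (circle_coef F n) r)%C.
Proof.
  intros HF H HG Hr. assert (Hs := sin_acute _ H).
  set (c := circle_coef F n).
  assert (Hc : forall t, Ccontinuous c t) by (intros; now apply circle_coef_continuous).
  set (p := fun u rho => (c rho * kernel theta q n (u / rho)%R)%C).
  set (dp := fun u rho => (c rho * C_derivative (kernel theta q n) (u / rho)%R * RtoC (/ rho))%C).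
  (* For [u] within this distance of [r] and [t] above [r] minus it, t - u sin theta > r (1 - sin
     theta) / 2, so the kernel is regular at u / t. *)
  assert (He : 0 < r * (1 - sin theta) / 4) by nra.
  assert (Hp : forall u t, Rabs (u - r) < r * (1 - sin theta) / 4 ->
    r - r * (1 - sin theta) / 4 < t ->
    is_C_derivative (fun z => p z t) u (dp u t) /\ Ccontinuous_2d dp u t
    /\ Ccontinuous (p u) t).
  { intros u t Hu Ht. apply Rabs_def2 in Hu.
    assert (Ht0 : 0 < t) by nra.
    assert (Hu0 : 0 < u) by nra.
    assert (Hk : -1 < u / t * sin theta < 1).
    { replace (u / t * sin theta) with (u * sin theta / t) by (field; lra). split.
      - apply Rlt_trans with 0; [lra|]. apply Rdiv_lt_0_compat; nra.
      - apply Rmult_lt_reg_r with t; [lra|].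
        unfold Rdiv. rewrite Rmult_assoc, Rinv_l by lra. nra. }
    assert (K := kernel_is_C_derivative theta q n _ Hk).
    split; [|split].
    - unfold p, dp. rewrite <- Cmult_assoc. apply is_C_derivative_scal.
      rewrite kernel_C_derivative by exact Hk.
      destruct K as [K1 K2].
      assert (Hdiv : is_derive (fun z => z / t) u (/ t)) by (auto_derive; lra).
      split.
      + rewrite re_scal_r, Rmult_comm.
        exact (is_derive_comp (fun y => Re (kernel theta q n y)) (fun z => z / t) u _ _ K1 Hdiv).
      + rewrite Cmult_comm, im_scal_l.
        exact (is_derive_comp (fun y => Im (kernel theta q n y)) (fun z => z / t) u _ _ K2 Hdiv).
    - now apply volterra_integrand_continuous_2d.
    - apply Ccontinuous_mult; [apply Hc|].
      apply (Ccontinuous_comp (kernel theta q n) (fun t => u / t)).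
      + apply @continuous_mult; [apply continuous_const|].
        apply continuous_Rinv_comp; [apply continuous_id | lra].
      + destruct K as [D1 D2].
        split; apply (ex_derive_continuous (V := R_NormedModule)); eexists; eassumption. }
  assert (HD : is_C_derivative (data_fourier Rad G q n) r
    (- (C_integral (dp r) r Rad - p r r))%C).
  (* Completing the first branch to [-Rad, Rad] isolates a constant, which carries the negative
     radii; what varies is minus an integral from [u] to [Rad] against the kernel. *)
  { apply is_C_derivative_ext_loc with
      (fun u => C_integral c (- Rad) Rad - C_integral (p u) u Rad)%C.
    - apply locally_interval with (a := Finite 0) (b := Finite Rad); simpl; try lra.
      intros u H1 H2. rewrite (data_fourier_eq Rad theta q n F G u) by (auto; lra).
      fold c.
      assert (X1 : ex_C_integral c (- Rad) u) by (apply ex_C_integral_cont; auto).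
      assert (X2 : ex_C_integral c u Rad) by (apply ex_C_integral_cont; auto).
      assert (X3 : ex_C_integral (p u) u Rad).
      { apply ex_C_integral_cont. rewrite Rmin_left, Rmax_right by lra. intros t Ht.
        apply Ccontinuous_mult; [apply Hc|].
        apply (Ccontinuous_comp (kernel theta q n) (fun t => u / t)).
        + apply @continuous_mult; [apply continuous_const|].
          apply continuous_Rinv_comp; [apply continuous_id | lra].
        + destruct (ray_radicand theta u t H ltac:(lra)) as [_ Hk].
          destruct (kernel_is_C_derivative theta q n (u / t) ltac:(lra)) as [D1 D2].
          split; apply (ex_derive_continuous (V := R_NormedModule)); eexists; eassumption. }
      rewrite <- (C_integral_Chasles c (- Rad) u Rad X1 X2).
      transitivity (C_integral c (- Rad) u + (C_integral c u Rad - C_integral (p u) u Rad))%C;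
        [ring|].
      rewrite <- C_integral_minus by assumption. f_equal.
      apply C_integral_ext; intros t _. unfold p. ring.
    - apply is_C_derivative_const_minus.
      apply (is_C_derivative_integral_lower p dp r Rad (mkposreal _ He)); [lra|].
      simpl. intros u t Hu Ht. apply Hp; [exact Hu | apply Ht]. }
  rewrite (is_C_derivative_unique _ _ _ HD).
  assert (Hk1 := kernel_1_neq0 theta q n H).
  unfold volterra. change (fun rho => _) with (dp r).
  unfold p. replace (r / r) with 1 by (field; lra). fold c. field. exact Hk1.
Qed.

Lemma radial_coefficient_circle_coef Rad theta q n F G r :
  (forall x y, Ccontinuous_2d F x y) -> 0 < Rad ->
  0 < theta < PI / 2 -> spin_data Rad theta q F G -> 0 < r < Rad ->
  radial_coefficient Rad theta G q n r = circle_coef F n r.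
Proof.
  intros HF HR H HG Hr. apply radial_coefficient_eq; auto.
  - intros t _. now apply circle_coef_continuous.
  - intros u Hu. now apply circle_coef_volterra.
Qed.

Lemma unit_circle_angle u v : u ^ 2 + v ^ 2 = 1 -> exists a, cis a = (u, v).
Proof.
  intros H. assert (Hu : -1 <= u <= 1) by nra.
  assert (Hs : sin (acos u) = Rabs v).
  { rewrite sin_acos by exact Hu. rewrite <- sqrt_Rsqr_abs. f_equal. unfold Rsqr. nra. }
  destruct (Rle_dec 0 v) as [Hv|Hv].
  - exists (acos u). unfold cis. rewrite cos_acos, Hs, Rabs_right by lra. reflexivity.
  - exists (- acos u). unfold cis. rewrite cos_neg, sin_neg, cos_acos, Hs, Rabs_left by lra.
    now rewrite Ropp_involutive.
Qed.

(** * Symmetric tensors in the null frame *)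

(** Sums over words leave equalities typed in the carrier of [C_AbelianMonoid]; they are restated
    over [C] for [ring]. *)
Ltac ring_C := match goal with |- ?a = ?b => change (@eq C a b) end; ring.

Lemma sum_words_S {G : AbelianMonoid} m (g : list axis -> G) :
  sum_words (S m) g = plus (sum_words m (fun I => g (ax1 :: I)))
                           (sum_words m (fun I => g (ax2 :: I))).
Proof. reflexivity. Qed.

Lemma sum_words_ext {G : AbelianMonoid} m (g h : list axis -> G) :
  (forall I, length I = m -> g I = h I) -> sum_words m g = sum_words m h.
Proof.
  revert g h; induction m as [|m IH]; intros g h H; simpl.
  - now apply H.
  - f_equal; apply IH; intros I HI; apply H; simpl; now rewrite HI.
Qed.

Lemma sum_words_morphism {G H : AbelianMonoid} (phi : G -> H) m (g : list axis -> G) :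
  (forall a b, phi (plus a b) = plus (phi a) (phi b)) ->
  phi (sum_words m g) = sum_words m (fun I => phi (g I)).
Proof.
  intros Hphi. revert g; induction m as [|m IH]; intros g; simpl; [reflexivity|].
  now rewrite Hphi, !IH.
Qed.

Lemma sum_words_plus {G : AbelianMonoid} m (g h : list axis -> G) :
  sum_words m (fun I => plus (g I) (h I)) = plus (sum_words m g) (sum_words m h).
Proof.
  revert g h; induction m as [|m IH]; intros g h; simpl; [reflexivity|].
  rewrite (IH (fun I => g (ax1 :: I)) (fun I => h (ax1 :: I))),
    (IH (fun I => g (ax2 :: I)) (fun I => h (ax2 :: I))).
  rewrite <- !plus_assoc. f_equal. rewrite !plus_assoc. f_equal. apply plus_comm.
Qed.

(** One induction serves continuity along rays, joint continuity (with [X] the plane) and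
    differentiability of contracted fields. *)
Lemma sum_words_closed {G : AbelianMonoid} {X : Type} (P : (X -> G) -> Prop) m
    (g : list axis -> X -> G) :
  (forall u v, P u -> P v -> P (fun x => plus (u x) (v x))) ->
  (forall I, length I = m -> P (g I)) ->
  P (fun x => sum_words m (fun I => g I x)).
Proof.
  intros HP. revert g; induction m as [|m IH]; intros g H; simpl.
  - now apply (H nil).
  - apply (HP (fun x => sum_words m (fun I => g (ax1 :: I) x))
      (fun x => sum_words m (fun I => g (ax2 :: I) x))).
    + apply (IH (fun I => g (ax1 :: I))); intros I HI; apply H; simpl; now rewrite HI.
    + apply (IH (fun I => g (ax2 :: I))); intros I HI; apply H; simpl; now rewrite HI.
Qed.

Lemma sum_words_scal (c : C) m (g : list axis -> C) :
  sum_words m (fun I => c * g I)%C = (c * sum_words m g)%C.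
Proof.
  symmetry. apply (sum_words_morphism (G := C_AbelianMonoid) (H := C_AbelianMonoid) (Cmult c)).
  intros a b. apply Cmult_plus_distr_l.
Qed.

(** The product of vectors u and w in the order dictated by the word [I]. Expanding products of u +
    iw and u - iw produces all words, whereas [mixed_tpow] has its factors w in front. *)
Fixpoint word_tensor (u w : R * R) (I J : list axis) : R :=
  match I, J with
  | i :: I', j :: J' =>
      coord (match i with ax1 => u | ax2 => w end) j * word_tensor u w I' J'
  | _, _ => 1
  end.

Definition symmetric_tensor (m : nat) (t : tensor) : Prop :=
  forall I J, length I = m -> Permutation I J -> t I = t J.

Lemma pairing_ext m (t t' g g' : tensor) :
  (forall I, length I = m -> t I = t' I) -> (forall I, length I = m -> g I = g' I) ->
  pairing m t g = pairing m t' g'.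
Proof.
  intros Ht Hg. apply sum_words_ext. intros I HI. now rewrite Ht, Hg.
Qed.

Lemma pairing_scal m (c : R) (t g : tensor) :
  pairing m t (fun I => c * g I) = c * pairing m t g.
Proof.
  unfold pairing. symmetry.
  rewrite (sum_words_morphism (G := R_AbelianMonoid) (H := R_AbelianMonoid) (Rmult c)).
  - apply sum_words_ext; intros I _. simpl. ring.
  - intros a b. apply Rmult_plus_distr_l.
Qed.

Lemma pairing_cons m t u w i I :
  pairing (S m) t (word_tensor u w (i :: I)) =
    coord (match i with ax1 => u | ax2 => w end) ax1
      * pairing m (fun J => t (ax1 :: J)) (word_tensor u w I)
    + coord (match i with ax1 => u | ax2 => w end) ax2
      * pairing m (fun J => t (ax2 :: J)) (word_tensor u w I).
Proof. rewrite <- !pairing_scal. reflexivity. Qed.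

Lemma symmetric_tensor_cons m t j :
  symmetric_tensor (S m) t -> symmetric_tensor m (fun J => t (j :: J)).
Proof.
  intros H I J HI HIJ. apply H; [simpl; now rewrite HI | now apply perm_skip].
Qed.

(** A transposition of the first two factors becomes a transposition of two indices of [t]. The
    tensor stays general in the induction because each step fixes one of its indices. *)
Lemma pairing_word_permutation u w I I' :
  Permutation I I' -> forall t, symmetric_tensor (length I) t ->
  pairing (length I) t (word_tensor u w I) = pairing (length I) t (word_tensor u w I').
Proof.
  induction 1 as [|i I I' HI IH|i j I|I I' I'' H1 IH1 H2 IH2]; intros t Ht.
  - reflexivity.
  - simpl length. rewrite !pairing_cons, !IH; auto; now apply symmetric_tensor_cons.
  - simpl length. rewrite !pairing_cons.
    (* Among the four terms in the first two indices, the off-diagonal ones are exchanged, and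
       symmetry identifies them. *)
    rewrite (pairing_ext _ (fun J => t (ax2 :: ax1 :: J)) (fun J => t (ax1 :: ax2 :: J))
      _ (word_tensor u w I)); [ring | | reflexivity].
    intros J HJ. apply Ht; [simpl; now rewrite HJ | apply perm_swap].
  - rewrite IH1 by exact Ht. rewrite (Permutation_length H1) in *. now apply IH2.
Qed.

Lemma word_tensor_mixed u w k n J :
  length J = (k + n)%nat ->
  word_tensor u w (repeat ax2 k ++ repeat ax1 n) J = mixed_tpow k w u J.
Proof.
  revert J; induction k as [|k IH]; intros J HJ; simpl in *.
  - transitivity (tpow u J); [|destruct J; reflexivity].
    revert J HJ; induction n as [|n IH]; intros [|j J] HJ; simpl in *; try lia; auto.
    rewrite IH; [reflexivity | lia].
  - destruct J as [|j J]; simpl in *; [lia|]. rewrite IH; [reflexivity | lia].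
Qed.

Lemma sorted_word I : exists n, length I = (count_ax2 I + n)%nat
  /\ Permutation I (repeat ax2 (count_ax2 I) ++ repeat ax1 n).
Proof.
  induction I as [|[|] I [n [Hn HI]]].
  - now exists O.
  - exists (S n). unfold count_ax2 in *; simpl. split; [lia|].
    simpl. now apply Permutation_cons_app.
  - exists n. unfold count_ax2 in *; simpl. split; [lia|]. now apply perm_skip.
Qed.

Lemma mixed_tpow_full w u J : mixed_tpow (length J) w u J = tpow w J.
Proof. induction J as [|j J IH]; simpl; congruence. Qed.

Lemma pairing_word_mixed m u w t I :
  length I = m -> symmetric_tensor m t ->
  pairing m t (word_tensor u w I) = pairing m t (mixed_tpow (count_ax2 I) w u).
Proof.
  intros <- Ht. destruct (sorted_word I) as [n [Hn HI]].
  rewrite (pairing_word_permutation u w _ _ HI t Ht).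
  apply pairing_ext; [reflexivity|]. intros J HJ. apply word_tensor_mixed. lia.
Qed.

Lemma spin_cons p P :
  spin (p :: P) = ((match p with ax1 => 1 | ax2 => -1 end) + spin P)%Z.
Proof. unfold spin, count_ax2. destruct p; simpl length; lia. Qed.

Definition unit_vector (a : R) : R * R := (cos a, sin a).

Definition unit_normal (a : R) : R * R := (- sin a, cos a).

(* [u + i w = exp (- i a) (1, i)] and [u - i w = exp (i a) (1, - i)]. *)
Lemma null_vector a p j :
  (null_frame p ax1 * RtoC (coord (unit_vector a) j)
   + null_frame p ax2 * RtoC (coord (unit_normal a) j))%C
  = (cis (- IZR (match p with ax1 => 1 | ax2 => -1 end) * a)%R * null_frame p j)%C.
Proof.
  assert (E1 : cis (- (1) * a) = (cos a, - sin a)).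
  { rewrite Ropp_mult_distr_l_reverse, Rmult_1_l. unfold cis. now rewrite cos_neg, sin_neg. }
  assert (E2 : cis (- -1 * a) = (cos a, sin a)).
  { replace (- -1 * a) with a by ring. reflexivity. }
  destruct p; rewrite ?E1, ?E2; destruct j; apply C_eq; simpl; ring.
Qed.

(** The sum factors slot by slot: the slot of p carries u + iw or u - iw, which [null_vector] turns
    into a phase times the null vector p. The exponents of the phases add up to the spin. *)
Lemma null_frame_pairing a m P t :
  length P = m ->
  sum_words m (fun I => coef_product null_frame P I
    * RtoC (pairing m t (word_tensor (unit_vector a) (unit_normal a) I)))%C
  = (cis (- IZR (spin P) * a)%R
     * sum_words m (fun J => coef_product null_frame P J * RtoC (t J)))%C.
Proof.
  revert m t; induction P as [|p P IH]; intros [|m] t Hm; simpl in Hm; try lia.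
  - simpl. unfold spin, count_ax2; simpl. rewrite Ropp_0, Rmult_0_l, cis_0.
    unfold pairing; simpl. now rewrite Rmult_1_r, !Cmult_1_l.
  - injection Hm as Hm. set (u := unit_vector a) in *. set (w := unit_normal a) in *.
    set (S1 := sum_words m (fun J => coef_product null_frame P J * RtoC (t (ax1 :: J)))%C).
    set (S2 := sum_words m (fun J => coef_product null_frame P J * RtoC (t (ax2 :: J)))%C).
    assert (Hi : forall i,
      sum_words m (fun I => coef_product null_frame (p :: P) (i :: I)
        * RtoC (pairing (S m) t (word_tensor u w (i :: I))))%C
      = (null_frame p i
         * (RtoC (coord (match i with ax1 => u | ax2 => w end) ax1)
            * (cis (- IZR (spin P) * a)%R * S1)
          + RtoC (coord (match i with ax1 => u | ax2 => w end) ax2)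
            * (cis (- IZR (spin P) * a)%R * S2)))%C).
    { intros i. unfold S1, S2. rewrite <- !IH by exact Hm.
      rewrite <- !sum_words_scal.
      rewrite <- (sum_words_plus (G := C_AbelianMonoid)), <- sum_words_scal.
      apply sum_words_ext; intros I _. rewrite pairing_cons, RtoC_plus, !RtoC_mult.
      simpl coef_product. change (@plus C_AbelianMonoid) with Cplus. ring_C. }
    assert (Hr : forall j, sum_words m (fun J => coef_product null_frame (p :: P) (j :: J)
        * RtoC (t (j :: J)))%C = (null_frame p j
      * sum_words m (fun J => coef_product null_frame P J * RtoC (t (j :: J))))%C).
    { intros j. rewrite <- sum_words_scal. apply sum_words_ext; intros J _.
      simpl coef_product. ring_C. }
    rewrite !(sum_words_S (G := C_AbelianMonoid)), !Hi, !Hr. fold S1 S2.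
    change (@plus C_AbelianMonoid) with Cplus.
    rewrite spin_cons, plus_IZR.
    replace (- (IZR (match p with ax1 => 1 | ax2 => -1 end) + IZR (spin P)) * a)
      with (- IZR (match p with ax1 => 1 | ax2 => -1 end) * a + - IZR (spin P) * a) by ring.
    rewrite cis_plus.
    assert (N1 := null_vector a p ax1). assert (N2 := null_vector a p ax2).
    fold u w in N1, N2.
    set (e := cis (- IZR (spin P) * a)) in *.
    set (e' := cis (- IZR _ * a)) in *.
    transitivity (e * S1 * (null_frame p ax1 * RtoC (coord u ax1)
        + null_frame p ax2 * RtoC (coord w ax1))
      + e * S2 * (null_frame p ax1 * RtoC (coord u ax2)
        + null_frame p ax2 * RtoC (coord w ax2)))%C; [ring_C|].
    rewrite N1, N2. ring_C.
Qed.

Lemma null_frame_dual i j :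
  (null_coframe ax1 i * null_frame ax1 j + null_coframe ax2 i * null_frame ax2 j)%C
  = match i, j with ax1, ax1 => RtoC 1 | ax2, ax2 => RtoC 1 | _, _ => RtoC 0 end.
Proof.
  destruct i, j; apply C_eq; simpl; field.
Qed.

(** Duality of frame and coframe, applied to one tensor slot at a time. *)
Lemma null_frame_inversion m I (t : list axis -> C) :
  length I = m ->
  sum_words m (fun P => coef_product null_coframe P I
    * sum_words m (fun J => coef_product null_frame P J * t J))%C = t I.
Proof.
  revert m t; induction I as [|i I IH]; intros [|m] t Hm; simpl in Hm; try lia.
  - simpl. ring_C.
  - injection Hm as Hm.
    assert (Hp : forall p, sum_words m (fun P => coef_product null_coframe (p :: P) (i :: I)
        * sum_words (S m) (fun J => coef_product null_frame (p :: P) J * t J))%C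
      = (null_coframe p i * null_frame p ax1 * t (ax1 :: I)
         + null_coframe p i * null_frame p ax2 * t (ax2 :: I))%C).
    { intros p. rewrite <- (IH m (fun J => t (ax1 :: J)) Hm), <- (IH m (fun J => t (ax2 :: J)) Hm).
      rewrite <- !sum_words_scal, <- (sum_words_plus (G := C_AbelianMonoid)).
      apply sum_words_ext; intros P _. simpl.
      change (@plus C_AbelianMonoid) with Cplus.
      rewrite (sum_words_ext (G := C_AbelianMonoid) m
        (fun J => (null_frame p ax1 * coef_product null_frame P J * t (ax1 :: J))%C)
        (fun J => (null_frame p ax1 * (coef_product null_frame P J * t (ax1 :: J)))%C))
        by (intros; symmetry; apply Cmult_assoc).
      rewrite (sum_words_ext (G := C_AbelianMonoid) m
        (fun J => (null_frame p ax2 * coef_product null_frame P J * t (ax2 :: J))%C)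
        (fun J => (null_frame p ax2 * (coef_product null_frame P J * t (ax2 :: J)))%C))
        by (intros; symmetry; apply Cmult_assoc).
      rewrite !sum_words_scal. ring_C. }
    rewrite (sum_words_S (G := C_AbelianMonoid)), !Hp.
    change (@plus C_AbelianMonoid) with Cplus.
    transitivity ((null_coframe ax1 i * null_frame ax1 ax1
        + null_coframe ax2 i * null_frame ax2 ax1)
        * t (ax1 :: I)
      + (null_coframe ax1 i * null_frame ax1 ax2
        + null_coframe ax2 i * null_frame ax2 ax2)
        * t (ax2 :: I))%C; [ring_C|].
    rewrite !null_frame_dual. destruct i; ring_C.
Qed.

(** * Inversion *)

(** The integral up to [y] is constant for y > L, so the limit at infinity is that of an eventually
    constant function. *)
Lemma RInt_gen_cutoff (g : R -> R) L :
  0 <= L -> (forall s, continuous g s) -> (forall s, L <= s -> g s = 0) ->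
  RInt_gen g (at_point 0) (Rbar_locally p_infty) = RInt g 0 L.
Proof.
  intros HL Hc H0. apply is_RInt_gen_unique.
  intros P HP.
  exists (fun x => x = 0) (fun y => L < y).
  - reflexivity.
  - now exists L.
  - intros x y -> Hy. exists (RInt g 0 L). split; [|now apply locally_singleton].
    simpl. rewrite <- (Rplus_0_r (RInt g 0 L)).
    apply (is_RInt_Chasles g 0 L y).
    + apply (RInt_correct g), ex_RInt_cont; auto.
    + apply is_RInt_ext with (fun _ => 0).
      * rewrite Rmin_left, Rmax_right by lra. intros s Hs. symmetry; apply H0; lra.
      * assert (E := is_RInt_const L y (0 : R)).
        unfold scal in E; simpl in E; unfold mult in E; simpl in E.
        now rewrite Rmult_0_r in E.
Qed.

Lemma data_component_eq Rad theta m f gL gT gM I phi d :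
  (1 <= m)%nat -> length I = m -> symmetric_field m f ->
  gL phi d = longitudinal Rad theta m f phi d ->
  gT phi d = transverse Rad theta m f phi d ->
  (forall k, (1 <= k <= m - 1)%nat -> gM k phi d = mixed Rad theta m k f phi d) ->
  data_component m gL gT gM I phi d
  = vline Rad theta m f (word_tensor (udir phi) (uperp phi) I)
      (word_tensor (vdir theta phi) (vperp theta phi) I) phi d.
Proof.
  intros Hm HI Hf HL HT HM.
  assert (Hsym : forall p, symmetric_tensor m (field_at f p)).
  { intros p J K HJ HJK. now apply Hf. }
  assert (Hv : forall A B A' B',
    (forall p, pairing m (field_at f p) A = pairing m (field_at f p) A') ->
    (forall p, pairing m (field_at f p) B = pairing m (field_at f p) B') ->
    vline Rad theta m f A B phi d = vline Rad theta m f A' B' phi d).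
  { intros A B A' B' HA HB. unfold vline. f_equal.
    - apply RInt_ext; intros s _; apply HA.
    - f_equal. apply functional_extensionality; intros s; apply HB. }
  (* The longitudinal and transverse transforms are the values k = 0 and k = m of the mixed one, so
     the three cases of [data_component] have a common form. *)
  transitivity (mixed Rad theta m (count_ax2 I) f phi d).
  2:{ apply Hv; intros p; symmetry; now apply pairing_word_mixed. }
  assert (Hk : (count_ax2 I <= m)%nat) by (destruct (sorted_word I) as [n [Hn _]]; lia).
  unfold data_component.
  destruct (Nat.eqb_spec (count_ax2 I) 0) as [E|E].
  - rewrite HL, E. apply Hv; intros p; apply pairing_ext; auto; intros J _;
      destruct J; reflexivity.
  - destruct (Nat.eqb_spec (count_ax2 I) m) as [E'|E'].
    + rewrite HT, E'. apply Hv; intros p; apply pairing_ext; auto; intros J HJ;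
        rewrite <- HJ; symmetry; apply mixed_tpow_full.
    + apply HM; lia.
Qed.

(** * Null components of a smooth field and their data *)

Definition null_field (m : nat) (f : tensor_field) (P : list axis) (x y : R) : C :=
  sum_words m (fun J => coef_product null_frame P J * RtoC (f J x y))%C.

Lemma C_integral_sum_words m (g : list axis -> R -> C) a b :
  (forall I, length I = m -> ex_C_integral (g I) a b) ->
  C_integral (fun s => sum_words m (fun I => g I s)) a b
  = sum_words m (fun I => C_integral (g I) a b).
Proof.
  intros H.
  enough (E : ex_C_integral (fun s => sum_words m (fun I => g I s)) a b
    /\ C_integral (fun s => sum_words m (fun I => g I s)) a b
       = sum_words m (fun I => C_integral (g I) a b)) by apply E.
  revert g H; induction m as [|m IH]; intros g H.
  - split; [now apply (H nil) | reflexivity].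
  - destruct (IH (fun I => g (ax1 :: I))) as [X1 E1].
    { intros I HI; apply H; simpl; now rewrite HI. }
    destruct (IH (fun I => g (ax2 :: I))) as [X2 E2].
    { intros I HI; apply H; simpl; now rewrite HI. }
    split; simpl.
    + now apply (ex_C_integral_plus _ _ _ _ X1 X2).
    + rewrite <- E1, <- E2. exact (C_integral_plus _ _ _ _ X1 X2).
Qed.

Lemma C_integral_RtoC (h : R -> R) a b :
  C_integral (fun s => RtoC (h s)) a b = RtoC (RInt h a b).
Proof.
  apply C_eq; simpl; [reflexivity|].
  rewrite RInt_const. unfold scal; simpl; unfold mult; simpl. ring.
Qed.

Lemma pairing_continuous_along_ray m f (A : tensor) (p u : R * R) s :
  (forall I, length I = m -> forall x y, continuity_2d_pt (f I) x y) ->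
  continuous (fun s => pairing m (field_at f (move p s u)) A) s.
Proof.
  intros Hf. unfold pairing.
  apply (sum_words_closed (G := R_AbelianMonoid) (fun g => continuous g s) m
    (fun I s => f I (fst (move p s u)) (snd (move p s u)) * A I)).
  - intros g h Hg Hh. exact (continuous_plus _ _ _ Hg Hh).
  - intros I HI. apply @continuous_mult; [|apply continuous_const].
    now apply continuous_along_ray, Hf.
Qed.

(** The direction is constant along a branch, so the phase of [null_frame_pairing] comes out of the
    integral. *)
Lemma null_integral m f P (p u : R * R) a (b c : R) :
  length P = m ->
  (forall I, length I = m -> forall x y, continuity_2d_pt (f I) x y) ->
  u = unit_vector a ->
  sum_words m (fun I => coef_product null_frame P I
    * RtoC (RInt (fun s => pairing m (field_at f (move p s u))
        (word_tensor u (unit_normal a) I)) b c))%C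
  = (cis (- IZR (spin P) * a)%R
     * C_integral (fun s => value_at (null_field m f P) (move p s u)) b c)%C.
Proof.
  intros HP Hf Hu.
  transitivity (C_integral (fun s => sum_words m (fun I => coef_product null_frame P I
    * RtoC (pairing m (field_at f (move p s u)) (word_tensor u (unit_normal a) I)))%C) b c).
  - rewrite C_integral_sum_words.
    + apply sum_words_ext; intros I HI. rewrite <- C_integral_RtoC, C_integral_scal; [reflexivity|].
      apply ex_C_integral_cont; intros s _.
      now apply Ccontinuous_RtoC, pairing_continuous_along_ray.
    + intros I HI. apply ex_C_integral_scal, ex_C_integral_cont; intros s _.
      now apply Ccontinuous_RtoC, pairing_continuous_along_ray.
  - rewrite <- C_integral_scal.
    + apply C_integral_ext; intros s _. rewrite Hu. now apply null_frame_pairing.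
    + apply ex_C_integral_cont; intros s _. unfold value_at, null_field.
      apply (sum_words_closed (G := C_AbelianMonoid) (fun g => Ccontinuous g s) m
        (fun J s => coef_product null_frame P J
          * RtoC (f J (fst (move p s u)) (snd (move p s u))))%C).
      * intros g h. exact (Ccontinuous_plus g h s).
      * intros I HI. apply Ccontinuous_mult; [apply Ccontinuous_const|].
        now apply Ccontinuous_RtoC, continuous_along_ray, Hf.
Qed.

(** Order 1 of [ex_diff_n] gives both partial derivatives and continuity of the first one, which is
    enough for a total differential. *)
Lemma smooth_differentiable g x y : smooth g ->
  exists lx ly, differentiable_pt_lim g x y lx ly.
Proof.
  intros Hg. exists (Derive (fun z => g z y) x), (Derive (fun z => g x z) y).
  apply filterdiff_differentiable_pt_lim.
  apply (is_derive_filterdiff g x y (fun u v => Derive (fun z => g z v) u)).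
  - apply filter_forall; intros [u v]. simpl. apply Derive_correct.
    apply (Hg 1%nat u v).
  - apply Derive_correct, (Hg 1%nat x y).
  - assert (C1 : continuity_2d_pt (fun u v => Derive (fun z => g z v) u) x y)
      by apply (Hg 1%nat x y).
    now apply continuity_2d_pt_filterlim in C1.
Qed.

Lemma smooth_continuous g x y : smooth g -> continuity_2d_pt g x y.
Proof. intros Hg. apply (Hg 0%nat x y). Qed.

Lemma null_field_continuous m f P x y :
  (forall I, length I = m -> smooth (f I)) -> Ccontinuous_2d (null_field m f P) x y.
Proof.
  intros Hf.
  apply (sum_words_closed (G := C_AbelianMonoid)
    (fun F => Ccontinuous_2d (fun u v => F (u, v)) x y) m
    (fun J p => coef_product null_frame P J * RtoC (f J (fst p) (snd p)))%C).
  - intros F G HF HG.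
    exact (Ccontinuous_2d_plus (fun u v => F (u, v)) (fun u v => G (u, v)) x y HF HG).
  - intros I HI. apply Ccontinuous_2d_mult; [apply Ccontinuous_2d_const|].
    apply Ccontinuous_2d_RtoC. now apply smooth_continuous, Hf.
Qed.

(** Chain rule along the circle of radius [rho]; it supplies the derivative at the point where the
    Fourier series is summed. *)
Lemma null_field_polar_derivative m f P a rho :
  (forall I, length I = m -> smooth (f I)) ->
  exists l, is_C_derivative (fun b => polar (null_field m f P) b rho) a l.
Proof.
  intros Hf. unfold polar, null_field.
  apply (sum_words_closed (G := C_AbelianMonoid)
    (fun F => exists l, is_C_derivative F a l) m
    (fun J b => coef_product null_frame P J * RtoC (f J (rho * cos b)%R (rho * sin b)%R))%C).
  - intros F G [l [H1 H2]] [k [H3 H4]]. exists (l + k)%C. split.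
    + exact (is_derive_plus _ _ _ _ _ H1 H3).
    + exact (is_derive_plus _ _ _ _ _ H2 H4).
  - intros I HI.
    destruct (smooth_differentiable (f I) (rho * cos a) (rho * sin a) (Hf I HI)) as [lx [ly HD]].
    assert (HE := derivable_pt_lim_comp_2d _ (fun b => rho * cos b) (fun b => rho * sin b) a
      _ _ (rho * - sin a) (rho * cos a) HD).
    exists (coef_product null_frame P I
      * RtoC (lx * (rho * - sin a) + ly * (rho * cos a))%R)%C.
    apply is_C_derivative_scal. split; simpl.
    + apply is_derive_Reals, HE; apply is_derive_Reals; auto_derive; trivial; ring.
    + apply @is_derive_const.
Qed.

Lemma null_data_spin Rad theta m f gL gT gM P :
  0 < theta < PI / 2 -> 0 < Rad -> (1 <= m)%nat -> symmetric_field m f ->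
  (forall I, length I = m -> smooth (f I)) ->
  (forall I, length I = m -> supported_in_disk (Rad * sin theta) (f I)) ->
  (forall phi d, 0 <= phi < 2 * PI -> 0 <= d <= 2 * Rad ->
     gL phi d = longitudinal Rad theta m f phi d) ->
  (forall phi d, 0 <= phi < 2 * PI -> 0 <= d <= 2 * Rad ->
     gT phi d = transverse Rad theta m f phi d) ->
  (forall k, (1 <= k <= m - 1)%nat ->
   forall phi d, 0 <= phi < 2 * PI -> 0 <= d <= 2 * Rad ->
     gM k phi d = mixed Rad theta m k f phi d) ->
  length P = m ->
  spin_data Rad theta (spin P) (null_field m f P) (null_data m gL gT gM P).
Proof.
  intros H HR Hm Hsym Hf Hsupp HL HT HM HP phi d L Hphi Hd HL0 Hout.
  assert (Hs := sin_acute _ H).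
  assert (Hc : forall I, length I = m -> forall x y, continuity_2d_pt (f I) x y).
  { intros; now apply smooth_continuous, Hf. }
  (* Both branches use the same rotating frame, at the angles phi + PI and phi + PI + theta, so that
     one pairing identity applies to each. *)
  assert (Eu : udir phi = unit_vector (phi + PI)).
  { unfold udir, unit_vector. now rewrite neg_cos, neg_sin. }
  assert (Ew : uperp phi = unit_normal (phi + PI)).
  { unfold uperp, unit_normal. rewrite neg_cos, neg_sin. f_equal; ring. }
  assert (Ev : vdir theta phi = unit_vector (phi + PI + theta)).
  { unfold vdir, unit_vector.
    replace (phi + PI + theta) with (theta + phi + PI) by ring. now rewrite neg_cos, neg_sin. }
  assert (Ez : vperp theta phi = unit_normal (phi + PI + theta)).
  { unfold vperp, unit_normal.
    replace (phi + PI + theta) with (theta + phi + PI) by ring.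
    rewrite neg_cos, neg_sin. f_equal; ring. }
  rewrite <- (null_integral m f P _ _ (phi + PI) 0 d HP Hc Eu).
  rewrite <- (null_integral m f P _ _ (phi + PI + theta) 0 L HP Hc Ev).
  rewrite <- (sum_words_plus (G := C_AbelianMonoid)).
  apply sum_words_ext; intros I HI.
  rewrite (data_component_eq Rad theta m f) by auto.
  change (@plus C_AbelianMonoid) with Cplus.
  rewrite <- Cmult_plus_distr_l, <- RtoC_plus. do 2 f_equal.
  rewrite Ew, Ez. unfold vline. f_equal.
  apply RInt_gen_cutoff; [exact HL0 | |].
  - intros s. now apply pairing_continuous_along_ray.
  - intros s Hls. specialize (Hout s Hls). simpl in Hout.
    unfold pairing.
    rewrite (sum_words_ext (G := R_AbelianMonoid) m _ (fun _ => 0)).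
    + clear. induction m as [|m IH]; simpl; [reflexivity|].
      rewrite IH. apply Rplus_0_l.
    + intros J HJ. unfold field_at. rewrite (Hsupp J HJ); [apply Rmult_0_l|].
      (* The strict gap between the two radii puts even the points at distance exactly [Rad] outside
         the support. *)
      assert ((Rad * sin theta) ^ 2 < Rad ^ 2); [|simpl in *; lra].
      rewrite Rpow_mult_distr. assert (0 < Rad ^ 2) by nra.
      assert (sin theta ^ 2 < 1) by nra. nra.
Qed.

Lemma fourier_sum_ext (c c' : Z -> C) z :
  (forall n, c n = c' n) -> fourier_sum c z = fourier_sum c' z.
Proof.
  intros H. unfold fourier_sum. rewrite H. f_equal.
  apply C_series_ext; intros j. now rewrite !H.
Qed.

Lemma null_component_eq Rad theta m f gL gT gM P x y :
  0 < theta < PI / 2 -> 0 < Rad ->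
  (forall I, length I = m -> smooth (f I)) ->
  spin_data Rad theta (spin P) (null_field m f P) (null_data m gL gT gM P) ->
  0 < x ^ 2 + y ^ 2 < Rad ^ 2 ->
  null_component Rad theta m gL gT gM P x y = null_field m f P x y.
Proof.
  intros H HR Hf HG Hxy. unfold null_component.
  set (r := sqrt (x ^ 2 + y ^ 2)).
  assert (Hr2 : r ^ 2 = x ^ 2 + y ^ 2) by (apply pow2_sqrt; lra).
  assert (Hr : 0 < r < Rad).
  { split; [now apply sqrt_lt_R0|].
    rewrite <- (sqrt_pow2 Rad) by lra. now apply sqrt_lt_1_alt; split; [lra|]. }
  set (F := null_field m f P) in *.
  assert (HF : forall u v, Ccontinuous_2d F u v)
    by (intros; now apply null_field_continuous).
  destruct (unit_circle_angle (x / r) (y / r)) as [a Ha].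
  { transitivity ((x ^ 2 + y ^ 2) / r ^ 2); [field; lra|]. rewrite <- Hr2. field; lra. }
  rewrite (fourier_sum_ext _ (fourier_coef (fun b => polar F b r))).
  2:{ intros n. exact (radial_coefficient_circle_coef Rad theta _ n F _ r HF HR H HG Hr). }
  rewrite <- Ha.
  destruct (null_field_polar_derivative m f P a r Hf) as [l Hl].
  rewrite (fourier_inversion _ l); [| | |exact Hl].
  - injection Ha as Ha1 Ha2. unfold polar. rewrite Ha1, Ha2. f_equal; field; lra.
  - intros t. exact (Ccontinuous_2d_slice_l _ _ _ (polar_continuous_2d F _ _ HF)).
  - intros t. apply polar_periodic.
Qed.

Theorem theorem2p9 :
  forall (Rad theta : R) (m : nat) (f : tensor_field),
  0 < Rad ->
  0 < theta < PI / 2 ->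
  (1 <= m)%nat ->
  symmetric_field m f ->
  (forall I, length I = m -> smooth (f I)) ->
  (forall I, length I = m -> supported_in_disk (Rad * sin theta) (f I)) ->
  forall (gL gT : R -> R -> R) (gM : nat -> R -> R -> R),
  (forall phi d, 0 <= phi < 2 * PI -> 0 <= d <= 2 * Rad ->
     gL phi d = longitudinal Rad theta m f phi d) ->
  (forall phi d, 0 <= phi < 2 * PI -> 0 <= d <= 2 * Rad ->
     gT phi d = transverse Rad theta m f phi d) ->
  (forall k, (1 <= k <= m - 1)%nat ->
   forall phi d, 0 <= phi < 2 * PI -> 0 <= d <= 2 * Rad ->
     gM k phi d = mixed Rad theta m k f phi d) ->
  forall I x y, length I = m ->
  f I x y = inversion_formula Rad theta m gL gT gM I x y.
Proof.
  intros Rad theta m f HR H Hm Hsym Hf Hsupp gL gT gM HL HT HM I x y HI.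
  assert (Hs := sin_acute _ H).
  assert (Hpunct : forall u v, 0 < u ^ 2 + v ^ 2 < Rad ^ 2 ->
    punctured_inversion Rad theta m gL gT gM I u v = f I u v).
  { intros u v Huv. unfold punctured_inversion.
    (* The components of f are real, so the outer [Re] of the formula can be removed and the
       inversion carried out in [C]. *)
    rewrite <- (re_RtoC (f I u v)). f_equal.
    rewrite <- (null_frame_inversion m I (fun J => RtoC (f J u v)) HI).
    apply (sum_words_ext (G := C_AbelianMonoid)); intros P HP. f_equal.
    apply null_component_eq; auto. now apply null_data_spin. }
  unfold inversion_formula.
  destruct (Rle_dec (Rad ^ 2) (x ^ 2 + y ^ 2)) as [Hout|Hin].
  - apply (Hsupp I HI).
    assert (0 < Rad ^ 2) by nra. assert (sin theta ^ 2 < 1) by nra.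
    rewrite Rpow_mult_distr. nra.
  - destruct (Req_EM_T (x ^ 2 + y ^ 2) 0) as [H0|H0].
    + assert (x = 0) as -> by nra. assert (y = 0) as -> by nra.
      (* On the first axis the formula agrees with the component for 0 < |t| < Rad, so its limit is
         the value at the origin by continuity. *)
      assert (Hlim : is_lim (fun t => punctured_inversion Rad theta m gL gT gM I t 0) 0 (f I 0 0)).
      { apply is_lim_ext_loc with (fun t => f I t 0).
        - exists (mkposreal Rad HR). intros t Ht Hne.
          change (Rabs (t - 0) < Rad) in Ht. rewrite Rminus_0_r in Ht.
          apply Rabs_def2 in Ht. symmetry; apply (Hpunct t 0).
          assert (0 < t ^ 2) by (destruct (Rdichotomy t 0 Hne); nra). nra.
        - apply (is_lim_continuity (fun t => f I t 0) 0), continuous_pt.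
          exact (continuity_2d_slice_l (f I) 0 0 (smooth_continuous _ _ _ (Hf I HI))). }
      now rewrite (is_lim_unique _ _ _ Hlim).
    + symmetry; apply Hpunct. split; [|lra].
      assert (0 <= x ^ 2 + y ^ 2) by nra. lra.
Qed.
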